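(* Let $n\ge1$ and $0\le k\le n-1$ be integers and let $$f(q)=\frac{\binom{n-1}{k}_q\,\binom{2n-k}{n-k-1}_q}{[n-k]_q}.$$ Let the cyclic group $\mathcal{C}_2$ act on $\mathrm{Inc}^k(2\times n)$, its non-identity element acting by K-evacuation $\mathcal{E}$. Then the triple $(\mathrm{Inc}^k(2\times n),\mathcal{C}_2,f)$ exhibits the cyclic sieving phenomenon; that is, $|\mathrm{Inc}^k(2\times n)|=f(1)$ and the number of $T\in\mathrm{Inc}^k(2\times n)$ with $\mathcal{E}(T)=T$ equals $f(-1)$.
   Context: Partitions are identified with Young diagrams in English convention; $|\lambda|$ is the number of boxes; $2\times n$ is the partition $(n,n)$. An increasing tableau of shape $\lambda$ is a filling of the boxes of $\lambda$ by positive integers, strictly increasing along rows and down columns, whose set of entries is $\{1,\dots,M\}$ for some $M$ (its maximum entry). $\mathrm{Inc}^k(\lambda)$ is the set of increasing tableaux of shape $\lambda$ with maximum entry $|\lambda|-k$. K-promotion: the SE-neighbors of a box are the (at most two) boxes of the shape immediately below it or immediately to its right. For an increasing tableau $T$ with maximum entry $M$, delete the entry $1$, leaving an empty box; then repeatedly, simultaneously on all empty boxes, until no empty box has an SE-neighbor: label each empty box by the minimal label among its SE-neighbors and remove that label from the SE-neighbor(s) in which it appears (an empty box with no SE-neighbor is left unchanged). Finally label all empty boxes by $M+1$ and subtract $1$ from every label; the result is $\mathcal{P}(T)$, an increasing tableau of the same shape and maximum entry. K-evacuation: $[T]_j$ is the Young diagram of boxes of $T$ with entry $\le j$; a chain $\emptyset=\mu_0\subseteq\cdots\subseteq\mu_M$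 encodes the filling with $j$ in every box of $\mu_j\setminus\mu_{j-1}$. For $T$ with maximum entry $M$, $\mathcal{E}(T)$ is the increasing tableau encoded by the chain $([\mathcal{P}^{M-j}(T)]_j)_{0\le j\le M}$; it is an involution on $\mathrm{Inc}^k(\lambda)$. Cyclic sieving: for a finite set $X$ with an action of $\mathcal{C}_N=\langle c\rangle$ and $f$ a polynomial (or a rational function regular at the relevant roots of unity), $(X,\mathcal{C}_N,f)$ has the cyclic sieving phenomenon if for all integers $m$ the number of elements of $X$ fixed by $c^m$ equals $f(\zeta^m)$, where $\zeta$ is a primitive $N$th root of unity. Notation: $[m]_q=1+q+\cdots+q^{m-1}$, $[m]_q!=\prod_{i=1}^m[i]_q$, $\binom{a}{b}_q=[a]_q!/([b]_q![a-b]_q!)$. *)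

(* Defs.v *)
From HB Require Import structures.
From mathcomp Require Import all_boot all_order all_algebra all_field.
From mathcomp Require Import fraction finmap.

Set Implicit Arguments.
Unset Strict Implicit.
Unset Printing Implicit Defensive.

Import Order.TTheory GRing.Theory Num.Theory.

Local Open Scope nat_scope.

(* A shape is the sequence of its row lengths; rows and columns are numbered
   from 0, rows going downwards. *)
Definition box (sh : seq nat) := {i : 'I_(size sh) & 'I_(nth 0 sh i)}.

Definition brow sh (b : box sh) : nat := tag b.
Definition bcol sh (b : box sh) : nat := tagged b.

Definition filling (sh : seq nat) := {ffun box sh -> nat}.

Definition max_entry sh (T : filling sh) : nat := \max_(b : box sh) T b.

Definition row_increasing sh (T : filling sh) : bool :=
  [forall b : box sh, forall b' : box sh,
    (brow b == brow b') && (bcol b < bcol b') ==> (T b < T b')].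

Definition col_increasing sh (T : filling sh) : bool :=
  [forall b : box sh, forall b' : box sh,
    (bcol b == bcol b') && (brow b < brow b') ==> (T b < T b')].

Definition entries_initial sh (T : filling sh) : bool :=
  [forall b : box sh, 0 < T b] &&
  all (fun v => [exists b : box sh, T b == v]) (iota 1 (max_entry T)).

Definition increasing_tableau sh (T : filling sh) : bool :=
  [&& row_increasing T, col_increasing T & entries_initial T].

Definition is_Inc sh (k : nat) (T : filling sh) : bool :=
  increasing_tableau T && (max_entry T + k == #|{: box sh}|).

(* The entries of the tableaux in Inc^k(sh) are at most the number of boxes, so
   that bounded fillings suffice to enumerate them; see [mem_Inc]. *)
Definition Inc sh (k : nat) : {fset filling sh} :=
  [fset T in [seq [ffun b => val (F b)]
                | F : {ffun box sh -> 'I_(#|{: box sh}|.+1)}]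
        | is_Inc k T]%fset.

Lemma mem_Inc sh k (T : filling sh) : (T \in Inc sh k) = is_Inc k T.
Proof.
rewrite !inE /= andb_idl // => /andP[_ /eqP maxT].
have leT b : T b < #|{: box sh}|.+1.
  by rewrite ltnS -maxT (leq_trans _ (leq_addr _ _)) // leq_bigmax.
apply/mapP; exists [ffun b => Ordinal (leT b)]; first by rewrite mem_enum.
by apply/ffunP => b; rewrite !ffunE.
Qed.

(* K-promotion.  [None] marks an empty box. *)
Definition partial_filling (sh : seq nat) := {ffun box sh -> option nat}.

Definition SE_neighbor sh (b b' : box sh) : bool :=
  ((brow b' == (brow b).+1) && (bcol b' == bcol b)) ||
  ((brow b' == brow b) && (bcol b' == (bcol b).+1)).

Definition seq_min (s : seq nat) : option nat :=
  if s is x :: s' then Some (foldr minn x s') else None.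

Definition SE_min_label sh (S : partial_filling sh) (b : box sh) : option nat :=
  seq_min (pmap S [seq b' <- enum {: box sh} | SE_neighbor b b']).

Definition delete_one sh (T : filling sh) : partial_filling sh :=
  [ffun b => if T b == 1 then None else Some (T b)].

Definition promotion_step sh (S : partial_filling sh) : partial_filling sh :=
  [ffun b =>
    if S b is Some x then
      if [exists b' : box sh,
           [&& S b' == None, SE_neighbor b' b & SE_min_label S b' == Some x]]
      then None else Some x
    else SE_min_label S b].

(* A step moves every empty box that has an SE-neighbor one antidiagonal
   further and does nothing once there is no such box, so iterating as many
   times as there are boxes amounts to iterating until no empty box has an
   SE-neighbor. *)
Definition promotion_slide sh (T : filling sh) : partial_filling sh :=
  iter #|{: box sh}| (@promotion_step sh) (delete_one T).

Definition Kpromotion sh (T : filling sh) : filling sh :=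
  [ffun b => (odflt (max_entry T).+1 (promotion_slide T b)).-1].

Definition boxes_le sh (T : filling sh) (j : nat) : {set box sh} :=
  [set b | T b <= j].

Definition filling_of_chain sh (M : nat) (mu : nat -> {set box sh}) :
    filling sh :=
  [ffun b => oapp val 0
    [pick j : 'I_M.+1 | (0 < j) && (b \in mu j :\: mu j.-1)]].

Definition Kevacuation sh (T : filling sh) : filling sh :=
  filling_of_chain (max_entry T)
    (fun j => boxes_le (iter (max_entry T - j) (@Kpromotion sh) T) j).

Local Open Scope ring_scope.

Local Notation "p %:F" := (tofrac p).

(* The rational function f is regular at x, with value v there. *)
Definition has_value (f : {fraction {poly algC}}) (x v : algC) : Prop :=
  exists p d : {poly algC},
    [/\ d.[x] != 0, f = p%:F / d%:F & v = p.[x] / d.[x]].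

Definition fixed_points (A : choiceType) (X : {fset A}) (c : A -> A) :
  {fset A} := [fset x in X | c x == x]%fset.

(* The first two clauses say that c generates an action of the cyclic group of
   order N on X; an integral power of c then acts as the power of c whose
   exponent is the residue modulo N. *)
Definition cyclic_sieving (A : choiceType) (X : {fset A}) (N : nat)
    (c : A -> A) (f : {fraction {poly algC}}) : Prop :=
  [/\ forall x, x \in X -> c x \in X,
      forall x, x \in X -> iter N c x = x
    & forall (z : algC) (m : int), N.-primitive_root z ->
        has_value f (z ^ m)
          (#|` fixed_points X (iter `|(m %% N%:Z)%Z|%N c)|%:R)].

Definition qint (m : nat) : {poly algC} := \sum_(i < m) 'X^i.

Definition qfact (m : nat) : {poly algC} := \prod_(1 <= i < m.+1) qint i.

(* Only meaningful for b <= a. *)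
Definition qbinom (a b : nat) : {fraction {poly algC}} :=
  (qfact a)%:F / ((qfact b)%:F * (qfact (a - b))%:F).

Definition fnk (n k : nat) : {fraction {poly algC}} :=
  qbinom (n - 1) k * qbinom (2 * n - k) (n - k - 1) / (qint (n - k))%:F.

(* Main.v *)
Require Import Defs.
From HB Require Import structures.
From mathcomp Require Import all_boot all_order all_algebra all_field.
From mathcomp Require Import fraction finmap.
From mathcomp Require Import zify ring lra.

Set Implicit Arguments.
Unset Strict Implicit.
Unset Printing Implicit Defensive.

Import Order.TTheory GRing.Theory Num.Theory.
Local Open Scope ring_scope.

(* An increasing tableau of shape 2 x n is read as a path: the value l makes it
   go down by one if l occurs in the lower row, and then up by one if l occurs
   in the upper row.  The columns increase when the path never goes below 0.

   K-promotion drops the first up step and otherwise acts only where the path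
   first comes down to 0 inside a step and where it first ends a step at 0, so
   that i promotions amount to reflecting the path from step i on at its running
   minima.  Hence the entries at most M - i of the i-th promotion, M being the
   maximum entry, fill two rows of lengths n - b(i) and n - a(i), where a(i) and
   b(i) count the entries at most i in the upper and lower rows.  These are the
   shapes that define K-evacuation, which is therefore the rotation by 180
   degrees composed with the reversal of the alphabet: it reverses the path.

   So f(1) has to count all paths and f(-1) the symmetric ones, that is, path
   prefixes of half the length.  Both numbers have closed forms proved from the
   recurrence on the last step, while f(-1) is computed by splitting off the
   factor (1 + q)^(m/2) of [m]_q!, whose exponents cancel in f. *)

Section CountLe.
Local Open Scope nat_scope.

Definition increasing_below (n : nat) (t : nat -> nat) :=
  forall i j, i < j -> j < n -> t i < t j.

Definition occurs (n : nat) (t : nat -> nat) (v : nat) : bool :=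
  has (fun c => t c == v) (iota 0 n).

Definition count_le (n : nat) (t : nat -> nat) (l : nat) : nat :=
  count (fun c => t c <= l) (iota 0 n).

Implicit Types (n l c : nat) (t : nat -> nat).

Lemma increasing_belowW m n t :
  m <= n -> increasing_below n t -> increasing_below m t.
Proof. by move=> le_mn tI i j lt_ij lt_jm; apply: tI => //; lia. Qed.

Lemma increasing_below_le n t i j :
  increasing_below n t -> i <= j -> j < n -> t i <= t j.
Proof.
move=> tI; rewrite leq_eqVlt => /predU1P[-> //|lt_ij] lt_jn.
by rewrite ltnW // tI.
Qed.

Lemma occursP n t v : reflect (exists2 c, c < n & t c = v) (occurs n t v).
Proof.
apply: (iffP hasP) => -[c].
  by rewrite mem_iota => lt_cn /eqP tc; exists c.
by move=> lt_cn tc; exists c; [rewrite mem_iota | apply/eqP].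
Qed.

Lemma count_leSn n t l : count_le n.+1 t l = count_le n t l + (t n <= l).
Proof. by rewrite /count_le -[n.+1]addn1 iotaD count_cat /= addn0. Qed.

Lemma occursSn n t v : occurs n.+1 t v = occurs n t v || (t n == v).
Proof. by rewrite /occurs -[n.+1]addn1 iotaD has_cat /= orbF. Qed.

Lemma count_le_size n t l : count_le n t l <= n.
Proof. by rewrite (leq_trans (count_size _ _)) // size_iota. Qed.

Lemma count_le_unique n t l A : A <= n ->
  (forall c, c < n -> (t c <= l) = (c < A)) -> count_le n t l = A.
Proof.
move=> le_An tA.
have le_minn m : m <= n -> count_le m t l = minn A m.
  by elim: m => [|m IHm] lt_mn; rewrite ?minn0 // count_leSn IHm ?tA; lia.
by rewrite le_minn // (minn_idPl le_An).
Qed.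

Lemma count_le_all n t l :
  (forall c, c < n -> t c <= l) -> count_le n t l = n.
Proof. by move=> tl; apply: count_le_unique => // c lt_cn; rewrite tl. Qed.

Lemma count_le_none n t l :
  (forall c, c < n -> l < t c) -> count_le n t l = 0.
Proof. by move=> tl; apply: count_le_unique => // c /tl; lia. Qed.

Lemma ltn_count_le n t l c :
  increasing_below n t -> c < n -> (c < count_le n t l) = (t c <= l).
Proof.
elim: n => // n IHn tI lt_cn; rewrite count_leSn.
case: (leqP (t n) l) => [le_tl|lt_lt].
  have le_l i : i <= n -> t i <= l.
    by move=> le_in; apply: leq_trans le_tl; apply: increasing_below_le tI _ _.
  by rewrite count_le_all ?addn1 ?lt_cn ?le_l // => i /ltnW/le_l.
rewrite addn0; move: lt_cn; rewrite ltnS leq_eqVlt => /predU1P[->|lt_cn].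
  by have := count_le_size n t l; lia.
by rewrite IHn //; apply: increasing_belowW tI.
Qed.

Lemma count_leS n t l : increasing_below n t ->
  count_le n t l.+1 = count_le n t l + occurs n t l.+1.
Proof.
elim: n => // n IHn tI; rewrite !count_leSn occursSn IHn; last first.
  exact: increasing_belowW tI.
have [tn|] := eqVneq (t n) l.+1; last by rewrite orbF; lia.
have /negPf-> : ~~ occurs n t l.+1.
  by apply/occursP => -[c lt_cn tc]; have := tI c n lt_cn (ltnSn n); lia.
by rewrite /=; lia.
Qed.

Lemma find_iota0 n (P : pred nat) c0 : c0 < n -> P c0 ->
  let A := find P (iota 0 n) in
  [/\ A <= c0, P A & forall c, c < A -> ~~ P c].
Proof.
move=> lt_c0n Pc0 A.
have hasA : has P (iota 0 n) by apply/hasP; exists c0; rewrite ?mem_iota.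
have ltAn : A < n by rewrite -[X in _ < X](size_iota 0 n) -has_find.
have notP c : c < A -> ~~ P c.
  move=> lt_cA; have := before_find 0 lt_cA.
  by rewrite nth_iota ?(ltn_trans lt_cA) // => ->.
have PA : P A by have := nth_find 0 hasA; rewrite nth_iota.
by split=> //; rewrite leqNgt; apply/negP => /notP; rewrite Pc0.
Qed.

End CountLe.

Section CountBijection.
Local Open Scope nat_scope.

Lemma eq_count0 (A : Type) (P : pred A) (s : seq A) :
  P =1 pred0 -> count P s = 0.
Proof. by move/eq_count->; apply: count_pred0. Qed.

Lemma leq_count_can_in (A B : eqType) (s1 : seq A) (s2 : seq B)
    (P1 : pred A) (P2 : pred B) (f : A -> B) (g : B -> A) : uniq s1 ->
  (forall x, x \in s1 -> P1 x -> [/\ f x \in s2, P2 (f x) & g (f x) = x]) ->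
  count P1 s1 <= count P2 s2.
Proof.
move=> uniq1 fP; rewrite -!size_filter -(size_map f); apply: uniq_leq_size.
  rewrite map_inj_in_uniq ?filter_uniq // => x y.
  rewrite !mem_filter => /andP[Px x_in] /andP[Py y_in] fxy.
  by have [_ _ <-] := fP x x_in Px; rewrite fxy; have [] := fP y y_in Py.
move=> y /mapP[x]; rewrite !mem_filter => /andP[Px x_in] ->.
by have [-> -> _] := fP x x_in Px.
Qed.

Lemma eq_count_can_in (A B : eqType) (s1 : seq A) (s2 : seq B)
    (P1 : pred A) (P2 : pred B) (f : A -> B) (g : B -> A) :
  uniq s1 -> uniq s2 ->
  (forall x, x \in s1 -> P1 x -> [/\ f x \in s2, P2 (f x) & g (f x) = x]) ->
  (forall y, y \in s2 -> P2 y -> [/\ g y \in s1, P1 (g y) & f (g y) = y]) ->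
  count P1 s1 = count P2 s2.
Proof.
move=> uniq1 uniq2 fP gP; apply/eqP; rewrite eqn_leq.
by rewrite (leq_count_can_in uniq1 fP) (leq_count_can_in uniq2 gP).
Qed.

End CountBijection.

Section RangeMin.
Local Open Scope nat_scope.

Definition range_min (f : nat -> nat) (i l : nat) : nat :=
  \big[minn/f l]_(i <= m < l) f m.

Implicit Types (f : nat -> nat) (i l m : nat).

Lemma range_min_recl f i l :
  i < l -> range_min f i l = minn (f i) (range_min f i.+1 l).
Proof. exact: big_ltn. Qed.

Lemma range_min_refl f l : range_min f l l = f l.
Proof. exact: big_geq. Qed.

Lemma range_min_le f i l m : i <= m <= l -> range_min f i l <= f m.
Proof.
case/andP; move Ed: (m - i) => d; elim: d i Ed => [|d IHd] i Ed le_im le_ml.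
  have -> : i = m by lia.
  move: le_ml; rewrite leq_eqVlt => /predU1P[->|lt_ml].
    by rewrite range_min_refl.
  by rewrite range_min_recl // geq_minl.
by rewrite range_min_recl ?geq_min ?IHd ?orbT; lia.
Qed.

Lemma range_min_attained f i l :
  i <= l -> exists2 m, i <= m <= l & range_min f i l = f m.
Proof.
move Ed: (l - i) => d; elim: d i Ed => [|d IHd] i Ed le_il.
  have -> : i = l by lia.
  by exists l; rewrite ?leqnn ?range_min_refl.
rewrite range_min_recl; last by lia.
have [||m m_in ->] := IHd i.+1; [lia | lia |].
by case: (leqP (f i) (f m)) => _; [exists i | exists m]; lia.
Qed.

End RangeMin.

Section Path.
Local Open Scope nat_scope.

(* [h l] is the height of a path after step l, and [v l] that of the valley in
   the middle of step l. *)
Variables (h v : nat -> nat) (down up : pred nat).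

Local Notation hmin := (range_min h).
Local Notation vmin := (range_min v).

(* The path is started at step i and reflected at its running minima. *)
Definition reflected_height (i m : nat) : nat :=
  h m + h i - (hmin i m + vmin i.+1 m).

Definition reflected_valley (i m : nat) : nat :=
  v m + h i - (hmin i m.-1 + vmin i.+1 m).

Hypotheses (path_down : forall l, h l = v l.+1 + down l.+1)
           (path_up : forall l, h l.+1 = v l.+1 + up l.+1).

Lemma reflected_height_return i l :
  i < l -> hmin i.+1 l <= h i -> ~~ down i.+1 ->
  exists2 m, i < m <= l & reflected_height i m = 0.
Proof.
move=> lt_il; have [m0 m0_in ->] := range_min_attained h lt_il => le_hm0 ndown.
have exm : exists m, (i < m) && (h m <= h i) by exists m0; lia.
case: (ex_minnP exm) => m /andP[lt_im le_hm] m_min.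
have lt_h t : i < t < m -> h i < h t.
  by move=> t_in; rewrite ltnNge; apply/negP => le_ht; have := m_min t; lia.
have le_v t : i < t <= m -> h i <= v t.
  case: t => // t t_in; have := path_down t; have := lt_h t.
  by have [->|] := eqVneq t i; lia.
exists m; first by have := m_min m0; lia.
apply/eqP; rewrite subn_eq0.
have [a a_in ->] := range_min_attained h (ltnW lt_im).
have [b b_in ->] := range_min_attained v lt_im.
have := le_v b b_in; suff : h i <= h a by lia.
have := lt_h a; have [-> //|ne_ai] := eqVneq a i.
have [->|] := eqVneq a m; last by lia.
have := le_v m; have := path_up m.-1; rewrite prednK; lia.
Qed.

(* The reflected path returns to 0 when the path first returns to height h i. *)
Lemma reflected_height_eq0 i l : i < l ->
  (exists2 m, i < m <= l & reflected_height i m = 0) <->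
  (~~ down i.+1) && (hmin i.+1 l <= h i).
Proof.
move=> lt_il; split=> [[m m_in /eqP]|/andP[ndown le_h]]; last first.
  exact: reflected_height_return.
rewrite subn_eq0 => le_min.
have := @range_min_le h i m i; have := @range_min_le h i m m.
have := @range_min_le v i.+1 m i.+1; have := @range_min_le h i.+1 l m.
by have := path_down i; lia.
Qed.

Lemma reflected_valley_return i l :
  i.+1 < l -> vmin i.+2 l <= v i.+1 -> up i.+1 ->
  exists2 m, i.+1 < m <= l & reflected_valley i m = 0.
Proof.
move=> lt_il; have [m0 m0_in ->] := range_min_attained v lt_il => le_vm0 up_i.
have exm : exists m, (i.+1 < m) && (v m <= v i.+1) by exists m0; lia.
case: (ex_minnP exm) => m /andP[lt_im le_vm] m_min.
have lt_v t : i.+1 < t < m -> v i.+1 < v t.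
  by move=> t_in; rewrite ltnNge; apply/negP => le_vt; have := m_min t; lia.
have lt_h t : i < t < m -> v i.+1 < h t.
  case: t => // t t_in; have := path_up t; have := lt_v t.+1.
  by have [->|] := eqVneq t i; lia.
exists m; first by have := m_min m0; lia.
have le_im : i <= m.-1 by lia.
apply/eqP; rewrite subn_eq0.
have [a a_in ->] := range_min_attained h le_im.
have [b b_in ->] := range_min_attained v (ltnW lt_im).
suff [] : v m <= v b /\ h i <= h a by lia.
split; last first.
  have := path_down i; have := lt_h a; have [-> //|] := eqVneq a i; lia.
have [-> //|ne_bi] := eqVneq b i.+1; have [-> //|ne_bm] := eqVneq b m.
by have := lt_v b; lia.
Qed.

Lemma reflected_valley_eq0 i l : i.+1 < l -> down i.+1 || up i.+1 ->
  (exists2 m, i.+1 < m <= l & reflected_valley i m = 0) <->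
  up i.+1 && (vmin i.+2 l <= v i.+1).
Proof.
move=> lt_il moves; split=> [[m m_in /eqP]|/andP[up_i le_v]]; last first.
  exact: reflected_valley_return.
rewrite subn_eq0 => le_min.
have := @range_min_le h i m.-1 i; have := @range_min_le h i m.-1 i.+1.
have := @range_min_le v i.+1 m i.+1; have := @range_min_le v i.+1 m m.
have := @range_min_le v i.+2 l m; have := path_down i; have := path_up i.
by case: (up i.+1) moves; lia.
Qed.

End Path.

(** * Two-row tableaux and their promotion *)

Section TwoRows.
Local Open Scope nat_scope.

(* Row [false] is the upper one; the columns from n on hold a sentinel. *)
Record tableau2 (n M : nat) (t : bool -> nat -> nat) : Prop := Tableau2 {
  row_lt : forall r, increasing_below n.+1 (t r);
  col_lt : forall c, c < n -> t false c < t true c;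
  entries_gt0 : forall r c, c < n -> 0 < t r c;
  row_end : forall r c, n <= c -> t r c = M.+1;
  entries_onto : forall v, 0 < v <= M ->
    occurs n (t false) v || occurs n (t true) v }.

(* The sliding empty box first touches the lower row in column
   [gap_col n t true] and leaves the upper row in column [gap_col n t false]. *)
Definition gap_col (n : nat) (t : bool -> nat -> nat) (touch : bool) : nat :=
  find (fun c => t true c < t false c.+1 + touch) (iota 0 n).

Definition slide (n : nat) (t : bool -> nat -> nat) (r : bool) (c : nat) :
    nat :=
  if r then if c < gap_col n t true then t true c else t true c.+1
  else if c < gap_col n t false then t false c.+1
  else t (c == gap_col n t false) c.

Definition promote (n : nat) (t : bool -> nat -> nat) (r : bool) (c : nat) :
    nat :=
  if c < n then (slide n t r c).-1 else t r c.

Lemma eq_promote n t t' : t =2 t' -> promote n t =2 promote n t'.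
Proof.
move=> tt' r c; have gapE b : gap_col n t b = gap_col n t' b.
  by apply: eq_find => i; rewrite !tt'.
by rewrite /promote /slide !gapE !tt'.
Qed.

Section Slide.
Variables (n M : nat) (t : bool -> nat -> nat).
Hypotheses (n_gt0 : 0 < n) (tT : tableau2 n M t).

Local Notation touch := (gap_col n t true).
Local Notation drop := (gap_col n t false).
Local Notation slide := (slide n t).

Lemma row_incr r : increasing_below n (t r).
Proof. exact: increasing_belowW (leqnSn n) (row_lt tT r). Qed.

Lemma row_le r i j : i <= j -> j <= n -> t r i <= t r j.
Proof. exact: increasing_below_le (row_lt tT r). Qed.

Lemma row_sentinel r : t r n = M.+1.
Proof. exact: row_end tT _ _ (leqnn n). Qed.

Lemma entries_le r c : c < n -> t r c <= M.
Proof. by move=> /(row_lt tT r)/(_ (ltnSn n)); rewrite row_sentinel. Qed.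

Lemma tableau2_max_gt1 : 1 < M.
Proof.
by have := entries_le true n_gt0; have := col_lt tT n_gt0;
  have := entries_gt0 tT false n_gt0; lia.
Qed.

Lemma first_entry : t false 0 = 1.
Proof.
have M_gt1 := tableau2_max_gt1; have := entries_onto tT (v := 1).
case/(_ ltac:(lia))/orP => /occursP[c lt_cn tc].
  by have := row_le false (leq0n c) (ltnW lt_cn);
    have := entries_gt0 tT false n_gt0; lia.
by have := col_lt tT lt_cn; have := entries_gt0 tT false lt_cn; lia.
Qed.

Lemma last_entry : t true n.-1 = M.
Proof.
have M_gt1 := tableau2_max_gt1; have lt_n1n : n.-1 < n by lia.
have := entries_le true lt_n1n; have := entries_onto tT (v := M).
case/(_ ltac:(lia))/orP => /occursP[c lt_cn tc].
  by have := entries_le true lt_cn; have := col_lt tT lt_cn; lia.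
by have := @row_le true c n.-1; lia.
Qed.

Lemma gap_col_spec b : [/\ gap_col n t b < n,
  t true (gap_col n t b) < t false (gap_col n t b).+1 + b
  & forall c, c < gap_col n t b -> t false c.+1 + b <= t true c].
Proof.
have lt_n1n : n.-1 < n by lia.
have [||le_gap gapP gap_min] :=
    @find_iota0 n (fun c => t true c < t false c.+1 + b) n.-1 => //.
  by rewrite prednK // row_sentinel; have := entries_le true lt_n1n; lia.
by split=> // [|c /gap_min]; [exact: leq_ltn_trans lt_n1n | rewrite -leqNgt].
Qed.

Lemma touch_le_drop : touch <= drop.
Proof.
have [_ gap_drop _] := gap_col_spec false.
have [_ _ touch_min] := gap_col_spec true.
by rewrite leqNgt; apply/negP => /touch_min; lia.
Qed.

Lemma slide_gt1 r c : c < n -> 1 < slide r c.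
Proof.
move=> lt_cn; have := col_lt tT lt_cn; have := entries_gt0 tT false lt_cn.
rewrite /slide; case: r => [|t_gt0 t_lt].
  by have := @row_lt _ _ _ tT true c c.+1; case: ifP; lia.
case: (ltngtP c drop) => [lt_c|lt_c|_]; last by lia.
  by have := @row_lt _ _ _ tT false c c.+1; lia.
by have := @row_incr false 0 c; rewrite first_entry; lia.
Qed.

Lemma slide_incr r : increasing_below n (slide r).
Proof.
move=> i j lt_ij lt_jn; rewrite /slide; case: r.
  by do 2![case: ifP => ?]; try lia; apply: (row_lt tT); lia.
have [lt_drop gap_drop drop_min] := gap_col_spec false; have incr := row_incr.
have le_row a b := @row_le false a b.
have lt_tj := col_lt tT lt_jn.
case: (ltngtP i drop) => [lt_i|lt_i|Ei];
  case: (ltngtP j drop) => [lt_j|lt_j|Ej]; try lia.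
- by apply: incr; lia.
- have := drop_min _ lt_i; have := @incr true i drop.
  by have := le_row drop.+1 j; lia.
- by have := drop_min _ lt_i; have := @incr true i j; lia.
- exact: incr.
- by rewrite Ei; have := le_row drop.+1 j; lia.
Qed.

Lemma slide_col_lt c : c < n -> slide false c < slide true c.
Proof.
move=> lt_cn; rewrite /slide; have := touch_le_drop.
have [_ _ touch_min] := gap_col_spec true.
have [_ _ drop_min] := gap_col_spec false.
have := @row_lt _ _ _ tT true c c.+1; have := col_lt tT lt_cn.
case: (ltngtP c drop) => [lt_c|lt_c|E]; case: ifP => [lt_ct|_]; try lia.
- by have := touch_min _ lt_ct; lia.
- by have := drop_min _ lt_c; lia.
Qed.

Lemma slide_le r c : c < n -> slide r c <= M.+1.
Proof.
move=> lt_cn; suff : slide true c <= M.+1.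
  by case: r => //; have := slide_col_lt lt_cn; lia.
rewrite /slide; have := entries_le true lt_cn; case: ifP => _; first by lia.
by have := @row_le true c.+1 n; rewrite row_sentinel; lia.
Qed.

Lemma slide_last : slide true n.-1 = M.+1.
Proof.
have [lt_touch _ _] := gap_col_spec true.
by rewrite /slide ifF ?prednK ?row_sentinel //; lia.
Qed.

Lemma slide_onto v : 1 < v <= M.+1 ->
  occurs n (slide false) v || occurs n (slide true) v.
Proof.
have le_td := touch_le_drop; have [lt_drop _ drop_min] := gap_col_spec false.
have [_ gap_touch _] := gap_col_spec true.
case/andP=> v_gt1; rewrite leq_eqVlt => /predU1P[-> | lt_vM].
  by apply/orP; right; apply/occursP; exists n.-1; [lia | exact: slide_last].
have := entries_onto tT (v := v).
case/(_ ltac:(lia))/orP => /occursP[c lt_cn tc].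
  apply/orP; left; apply/occursP; case: (ltnP drop c) => [lt_c|le_c].
    by exists c; rewrite // /slide; case: ltngtP lt_c.
  case: c lt_cn tc le_c => [|c] lt_cn tc lt_c.
    by rewrite first_entry in tc; lia.
  by exists c; [lia | rewrite /slide lt_c].
case: (ltngtP c touch) => [lt_c|lt_c|Ec]; apply/orP.
- by right; apply/occursP; exists c; rewrite // /slide lt_c.
- right; apply/occursP; exists c.-1; first by lia.
  by rewrite /slide prednK ?ifF //; lia.
left; apply/occursP; exists c => //; rewrite /slide.
move: le_td; rewrite -Ec leq_eqVlt => /predU1P[<-|lt_td].
  by rewrite ltnn eqxx.
by rewrite lt_td; have := drop_min _ lt_td; rewrite -Ec in gap_touch; lia.
Qed.

Lemma occurs_promote r v : occurs n (promote n t r) v = occurs n (slide r) v.+1.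
Proof.
apply: eq_in_has => c; rewrite mem_iota => /= lt_cn; rewrite /promote lt_cn.
by have := @slide_gt1 r c; lia.
Qed.

Lemma count_le_promote r l :
  count_le n (promote n t r) l = count_le n (slide r) l.+1.
Proof.
apply: eq_in_count => c; rewrite mem_iota => /= lt_cn; rewrite /promote lt_cn.
by have := @slide_gt1 r c; lia.
Qed.

Lemma tableau2_promote : tableau2 n M (promote n t).
Proof.
have slide_M r c : c < n -> 1 < slide r c <= M.+1.
  by move=> lt_cn; rewrite slide_gt1 ?slide_le.
split=> [r i j lt_ij le_jn|c lt_cn|r c lt_cn|r c le_nc|v v_in];
  rewrite /promote.
- have lt_in : i < n by lia.
  rewrite lt_in; case: (ltnP j n) => [lt_jn|le_nj]; have := slide_M r i lt_in.
    by have := slide_incr r lt_ij lt_jn; have := slide_M r j lt_jn; lia.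
  by rewrite (_ : j = n) ?row_sentinel; lia.
- rewrite lt_cn; have := slide_M false c lt_cn.
  by have := slide_col_lt lt_cn; lia.
- by rewrite lt_cn; have := slide_M r c lt_cn; lia.
- by rewrite ltnNge le_nc /= (row_end tT).
by rewrite !occurs_promote; apply: slide_onto; lia.
Qed.

Lemma count_le_slide_upper l : 0 < l <= M ->
  (count_le n (slide false) l).+1 =
    count_le n (t false) l + (t true drop <= l).
Proof.
move=> l_in; have [lt_drop gap_drop _] := gap_col_spec false.
have countP c := @ltn_count_le n (t false) l c (@row_incr false).
have count_max := count_le_size n (t false) l.
have count_gt0 : 0 < count_le n (t false) l.
  by rewrite countP // first_entry; lia.
have count_drop : t true drop <= l \/ count_le n (t false) l <= drop.+1.
  case: (leqP (t true drop) l) => [|lt_l]; [by left | right].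
  rewrite leqNgt; apply/negP => lt_count.
  by have := countP drop.+1; lia.
pose A := (count_le n (t false) l + (t true drop <= l)).-1.
rewrite (@count_le_unique _ _ _ A) {}/A; [lia | lia | move=> c lt_cn].
have lt_tc := col_lt tT lt_cn; have := countP c lt_cn; rewrite /slide.
case: (ltngtP c drop) => [lt_c|lt_c|Ec].
- by have := countP drop lt_drop; have := countP c.+1;
    have := col_lt tT lt_drop; lia.
- by have := @row_le false drop.+1 c; lia.
- by have := countP c.+1; rewrite Ec in lt_tc *; lia.
Qed.

Lemma count_le_slide_lower l : l <= M ->
  count_le n (slide true) l + (t true touch <= l) = count_le n (t true) l.
Proof.
move=> le_lM; have [lt_touch _ _] := gap_col_spec true.
have countP c := @ltn_count_le n (t true) l c (@row_incr true).
have count_max := count_le_size n (t true) l.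
have count_touch := countP touch lt_touch.
pose A := count_le n (t true) l - (t true touch <= l).
rewrite (@count_le_unique _ _ _ A) {}/A; [lia | lia | move=> c lt_cn].
have := countP c lt_cn; rewrite /slide; case: ifP => lt_c.
  by have := @row_incr true c touch; lia.
have := @row_le true touch c; have := countP c.+1.
case: (ltnP c.+1 n) => [|le_nc]; first by lia.
by rewrite (_ : c.+1 = n) ?row_sentinel; lia.
Qed.

Lemma gap_colP (b : bool) l : l <= M ->
  reflect (exists2 m, b < m <= l
             & count_le n (t false) (m - b) <= count_le n (t true) m)
    (t true (gap_col n t b) <= l).
Proof.
move=> le_lM; have [lt_gap gapP gap_min] := gap_col_spec b.
have countP r k c := @ltn_count_le n (t r) k c (@row_incr r).
have count_max r := count_le_size n (t r).
have := col_lt tT lt_gap; have := entries_gt0 tT false lt_gap.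
set g := gap_col n t b in lt_gap gapP gap_min * => t_gt0 lt_t.
apply: (iffP idP) => [le_gl|[m m_in le_count]].
  exists (t true g); first by lia.
  have := countP true (t true g) g lt_gap; rewrite leqnn; apply: leq_trans.
  rewrite leqNgt; apply/negP => lt_count.
  by have := countP false (t true g - b) g.+1;
    have := count_max false (t true g - b); lia.
have count_gt0 : 0 < count_le n (t false) (m - b).
  by rewrite countP // first_entry; lia.
have [q Eq] : {q | count_le n (t true) m = q.+1}.
  by exists (count_le n (t true) m).-1; lia.
have lt_qn : q < n by have := count_max true m; lia.
have le_tq : t true q <= m by rewrite -countP // Eq.
have lt_tq : m - b < t false q.+1.
  have [lt_q1n|le_nq1] := ltnP q.+1 n; first by rewrite ltnNge -countP //; lia.
  by rewrite (_ : q.+1 = n) ?row_sentinel; lia.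
have le_gq : g <= q by rewrite leqNgt; apply/negP => /gap_min; lia.
by have := @row_le true g q; lia.
Qed.

Lemma lower_count_le l : count_le n (t true) l <= count_le n (t false) l.-1.
Proof.
rewrite leqNgt; apply/negP => lt_count.
have lt_qn := leq_trans lt_count (count_le_size n (t true) l).
have := @ltn_count_le n (t true) l _ (@row_incr true) lt_qn.
have := @ltn_count_le n (t false) l.-1 _ (@row_incr false) lt_qn.
by have := col_lt tT lt_qn; have := entries_gt0 tT false lt_qn; lia.
Qed.

Lemma row_count0 r : count_le n (t r) 0 = 0.
Proof. exact: count_le_none (entries_gt0 tT r). Qed.

Lemma row_count_max r : count_le n (t r) M = n.
Proof. exact: count_le_all (entries_le r). Qed.

End Slide.

(* In the path of a tableau, [height t l] is the height after step l and
   [valley t l] that after the down part of step l. *)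
Definition height (n : nat) (t : bool -> nat -> nat) (l : nat) : nat :=
  count_le n (t false) l - count_le n (t true) l.

Definition valley (n : nat) (t : bool -> nat -> nat) (l : nat) : nat :=
  count_le n (t false) l.-1 - count_le n (t true) l.

Section Heights.
Variables (n M : nat) (t : bool -> nat -> nat).
Hypotheses (n_gt0 : 0 < n) (tT : tableau2 n M t).

Lemma height_down l : height n t l = valley n t l.+1 + occurs n (t true) l.+1.
Proof.
have := lower_count_le n_gt0 tT l.+1; rewrite /height /valley.
by rewrite count_leS /=; [lia | exact: row_incr tT _].
Qed.

Lemma height_up l : height n t l.+1 = valley n t l.+1 + occurs n (t false) l.+1.
Proof.
have := lower_count_le n_gt0 tT l.+1; rewrite /height /valley.
by rewrite [count_le n (t false) l.+1]count_leS /=;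
  [lia | exact: row_incr tT _].
Qed.

Lemma count_le_height l :
  count_le n (t false) l = count_le n (t true) l + height n t l.
Proof.
rewrite /height; have := lower_count_le n_gt0 tT l.
case: l => [|l] /=; first by lia.
by rewrite (@count_leS n (t false) l); [lia | exact: row_incr tT _].
Qed.

Lemma count_le_valley l :
  count_le n (t false) l.-1 = count_le n (t true) l + valley n t l.
Proof. by rewrite subnKC // (lower_count_le n_gt0 tT). Qed.

End Heights.

End TwoRows.

Section Rectification.
Local Open Scope nat_scope.
Variables (n M : nat) (t : bool -> nat -> nat).
Hypotheses (n_gt0 : 0 < n) (tT : tableau2 n M t).

Local Notation upper := (count_le n (t false)).
Local Notation lower := (count_le n (t true)).
Local Notation h := (height n t).
Local Notation v := (valley n t).

(* The entries of t' correspond to those of t exceeding i, in the sense that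
   the path of t' is the one of t, started at step i and reflected at its
   running minima. *)
Definition rectifies (i : nat) (t' : bool -> nat -> nat) : Prop :=
  forall l, i < l <= M ->
    count_le n (t' false) (l - i) + lower i + range_min h i l = upper l /\
    count_le n (t' true) (l - i) + upper i = lower l + range_min v i.+1 l.

Lemma rectifies0 : rectifies 0 t.
Proof.
move=> l l_in; have := row_count0 tT; rewrite subn0 => count0.
have := @range_min_le h 0 l 0; have := @range_min_le v 1 l 1.
by rewrite /height /valley /= !count0; lia.
Qed.

Section RectifiesPromote.
Variables (i : nat) (t' : bool -> nat -> nat).
Hypotheses (t'T : tableau2 n M t') (t'R : rectifies i t').

Lemma rectifies_drop l : i < l <= M ->
  (t' true (gap_col n t' false) <= l - i) =
    ~~ occurs n (t true) i.+1 && (range_min h i.+1 l <= h i).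
Proof.
move=> l_in; have le_liM : l - i <= M by lia.
have lt_il : i < l by lia.
have returns :=
  reflected_height_eq0 (height_down n_gt0 tT) (height_up n_gt0 tT) lt_il.
have countE := count_le_height n_gt0 tT.
apply/(gap_colP n_gt0 t'T false le_liM)/idP =>
  [[m m_in le_count]|/returns[m m_in reflected0]].
  apply/returns; exists (m + i); first by lia.
  rewrite /reflected_height.
  rewrite /= subn0 in le_count.
  have := @t'R (m + i); have := countE (m + i); have := countE i.
  by rewrite addnK; lia.
exists (m - i); first by lia.
move: reflected0; rewrite /reflected_height /= subn0.
by have := @t'R m; have := countE m; have := countE i; lia.
Qed.

Lemma rectifies_touch l : i.+1 < l <= M ->
  (t' true (gap_col n t' true) <= l - i) =
    occurs n (t false) i.+1 && (range_min v i.+2 l <= v i.+1).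
Proof.
move=> l_in; have le_liM : l - i <= M by lia.
have lt_il : i.+1 < l by lia.
have moves : occurs n (t true) i.+1 || occurs n (t false) i.+1.
  by rewrite orbC (entries_onto tT) //; lia.
have returns :=
  reflected_valley_eq0 (height_down n_gt0 tT) (height_up n_gt0 tT) lt_il moves.
have countE := count_le_valley n_gt0 tT.
have countE_i := count_le_height n_gt0 tT i.
apply/(gap_colP n_gt0 t'T true le_liM)/idP =>
  [[m m_in le_count]|/returns[m m_in reflected0]].
  apply/returns; exists (m + i); first by lia.
  rewrite /reflected_valley.
  have := @t'R (m + i); have := @t'R (m + i).-1; have := countE (m + i).
  by rewrite addnK (_ : (m + i).-1 - i = m - true); lia.
exists (m - i); first by lia.
move: reflected0; rewrite /reflected_valley.
have := @t'R m; have := @t'R m.-1; have := countE m.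
by rewrite (_ : m.-1 - i = m - i - true); lia.
Qed.

Lemma rectifies_promote : rectifies i.+1 (promote n t').
Proof.
move=> l l_in; have lt_il : i < l <= M by lia.
have le_lM : 0 < l - i <= M by lia.
have [upperE lowerE] := t'R lt_il.
have := count_le_slide_upper n_gt0 t'T le_lM.
have := count_le_slide_lower n_gt0 t'T (proj2 (andP le_lM)).
rewrite !(count_le_promote n_gt0 t'T) (_ : (l - i.+1).+1 = l - i); last by lia.
rewrite rectifies_drop // rectifies_touch // => countL countU.
rewrite (@range_min_recl _ i) in upperE; last by lia.
rewrite (@range_min_recl _ i.+1) in lowerE; last by lia.
have le_h : range_min h i.+1 l <= h i.+1 by apply: range_min_le; lia.
have le_v : range_min v i.+2 l <= v i.+2 by apply: range_min_le; lia.
have := entries_onto tT (v := i.+1) ltac:(lia).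
have := height_down n_gt0 tT i; have := height_up n_gt0 tT i.
have := height_down n_gt0 tT i.+1.
rewrite !(@count_leS _ _ i); [|exact: row_incr tT _|exact: row_incr tT _].
move: countU countL upperE lowerE le_h le_v.
case: (occurs n (t false) i.+1); case: (occurs n (t true) i.+1) => //=.
all: split; lia.
Qed.

End RectifiesPromote.

Lemma rectifies_iter_promote i :
  tableau2 n M (iter i (promote n) t) /\ rectifies i (iter i (promote n) t).
Proof.
elim: i => [|i [t'T t'R]]; first by split=> //; exact: rectifies0.
by split; [exact: tableau2_promote | exact: rectifies_promote].
Qed.

Lemma count_le_iter_promote r i : i <= M ->
  count_le n (iter i (promote n) t r) (M - i) + count_le n (t (~~ r)) i = n.
Proof.
have [t'T t'R] := rectifies_iter_promote i.
rewrite leq_eqVlt => /predU1P[->|lt_iM].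
  have [t''T _] := rectifies_iter_promote M.
  by rewrite subnn (row_count0 t''T) (row_count_max tT).
have := @t'R M; have := @range_min_le h i M M; have := @range_min_le v i.+1 M M.
have := count_le_height n_gt0 tT M; have := height_up n_gt0 tT M.-1.
by rewrite !(row_count_max tT) prednK; case: r => /=; lia.
Qed.

End Rectification.

(** * K-promotion and K-evacuation of fillings *)

Section Boxes.
Local Open Scope nat_scope.
Variable n : nat.

Definition cell (r : bool) (c : 'I_n) : box [:: n; n] :=
  if r then existT (fun i : 'I_2 => 'I_(nth 0 [:: n; n] i)) (@Ordinal 2 1 isT) c
  else existT (fun i : 'I_2 => 'I_(nth 0 [:: n; n] i)) (@Ordinal 2 0 isT) c.

Lemma brow_cell r c : brow (cell r c) = r.
Proof. by case: r. Qed.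

Lemma bcol_cell r c : bcol (cell r c) = c.
Proof. by case: r. Qed.

Lemma cell_ind (P : box [:: n; n] -> Prop) :
  (forall r c, P (cell r c)) -> forall b, P b.
Proof.
move=> Pcell [[[|[|i]] lti] c] //.
- by have -> : lti = isT by [apply: bool_irrelevance]; exact: (Pcell false c).
- by have -> : lti = isT by [apply: bool_irrelevance]; exact: (Pcell true c).
Qed.

Lemma cell_eqE r r' c c' : (cell r c == cell r' c') = (r == r') && (c == c').
Proof.
apply/eqP/andP => [E|[/eqP-> /eqP-> //]].
have := congr1 (@brow _) E; have := congr1 (@bcol _) E.
by rewrite !brow_cell !bcol_cell => /val_inj->; case: r r' {E} => [] [].
Qed.

Lemma card_box2 : #|{: box [:: n; n]}| = 2 * n.
Proof.
rewrite card_tagged sumnE big_map big_enum /= !big_ord_recl big_ord0 /=.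
by rewrite !card_ord; lia.
Qed.

Lemma SE_neighbor_cell r c r' c' : SE_neighbor (cell r c) (cell r' c') =
  [&& ~~ r, r' & c' == c] || (r == r') && (c' == c.+1 :> nat).
Proof.
by rewrite /SE_neighbor !brow_cell !bcol_cell -val_eqE; case: r; case: r'.
Qed.

Definition entry (T : filling [:: n; n]) (r : bool) (c : nat) : nat :=
  oapp (fun o => T (cell r o)) (max_entry T).+1 (insub c).

Lemma entry_cell T r (c : 'I_n) : entry T r c = T (cell r c).
Proof. by rewrite /entry valK. Qed.

Lemma entry_default T r c : n <= c -> entry T r c = (max_entry T).+1.
Proof. by move=> le_nc; rewrite /entry insubN // -leqNgt. Qed.

Lemma entry_le_max T r c : c < n -> entry T r c <= max_entry T.
Proof.
by move=> lt_cn; rewrite (entry_cell T r (Ordinal lt_cn)) /max_entry leq_bigmax.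
Qed.

Lemma tableau2_entry T :
  increasing_tableau T -> tableau2 n (max_entry T) (entry T).
Proof.
case/and3P=> /forallP rowT /forallP colT /andP[/forallP gt0T /allP ontoT].
split.
- move=> r i j lt_ij; rewrite ltnS leq_eqVlt => /predU1P[Ej|lt_jn].
    by rewrite Ej [ltnRHS]entry_default // ltnS entry_le_max // -Ej.
  have lt_in := ltn_trans lt_ij lt_jn.
  rewrite (entry_cell T r (Ordinal lt_in)) (entry_cell T r (Ordinal lt_jn)).
  have /forallP/(_ (cell r (Ordinal lt_jn)))/implyP :=
    rowT (cell r (Ordinal lt_in)).
  by apply; rewrite !brow_cell !bcol_cell eqxx.
- move=> c lt_cn; rewrite !(entry_cell T _ (Ordinal lt_cn)).
  have /forallP/(_ (cell true (Ordinal lt_cn)))/implyP :=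
    colT (cell false (Ordinal lt_cn)).
  by apply; rewrite !brow_cell !bcol_cell eqxx.
- by move=> r c lt_cn; rewrite (entry_cell T r (Ordinal lt_cn)).
- exact: entry_default.
move=> v v_in; have /ontoT/existsP[] : v \in iota 1 (max_entry T).
  by rewrite mem_iota add1n ltnS.
apply: cell_ind => r c /eqP tc; apply/orP.
have occ : occurs n (entry T r) v.
  by apply/occursP; exists c; rewrite ?entry_cell.
by case: r occ {tc}; [right | left].
Qed.

Lemma max_entry_tableau2 (T : filling [:: n; n]) M t :
  0 < n -> tableau2 n M t ->
  (forall r c, T (cell r c) = t r c) -> max_entry T = M.
Proof.
move=> n_gt0 tT TE; apply/eqP; rewrite eqn_leq; apply/andP; split.
  by apply/bigmax_leqP => b _; elim/cell_ind: b => r c;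
    rewrite TE (entries_le tT).
have lt_n1n : n.-1 < n by lia.
rewrite -(last_entry n_gt0 tT) -(TE true (Ordinal lt_n1n)).
exact: leq_bigmax.
Qed.

Lemma increasing_tableau2 (T : filling [:: n; n]) M t :
  0 < n -> tableau2 n M t ->
  (forall r c, T (cell r c) = t r c) -> increasing_tableau T.
Proof.
move=> n_gt0 tT TE; have maxT := max_entry_tableau2 n_gt0 tT TE.
apply/and3P; split.
- apply/forallP; apply: cell_ind => r c.
  apply/forallP; apply: cell_ind => r' c'.
  apply/implyP; rewrite !brow_cell !bcol_cell !TE => /andP[/eqP Er].
  have {Er} <- : r = r' by case: r r' Er => [] [].
  by move/(row_incr tT r); apply.
- apply/forallP; apply: cell_ind => r c.
  apply/forallP; apply: cell_ind => r' c'.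
  apply/implyP; rewrite !brow_cell !bcol_cell !TE => /andP[/eqP<-].
  by case: r r' => [] [] // _; apply: (col_lt tT).
apply/andP; split.
  by apply/forallP; apply: cell_ind => r c; rewrite TE (entries_gt0 tT).
apply/allP => v; rewrite mem_iota maxT add1n ltnS => /(entries_onto tT).
by case/orP=> /occursP[c lt_cn tc]; apply/existsP;
  [exists (cell false (Ordinal lt_cn)) | exists (cell true (Ordinal lt_cn))];
  rewrite TE /= tc.
Qed.

Lemma is_Inc_tableau2 (T : filling [:: n; n]) k : 0 < n ->
  is_Inc k T <-> tableau2 n (max_entry T) (entry T) /\ max_entry T + k = 2 * n.
Proof.
move=> n_gt0; rewrite /is_Inc card_box2; split=> [|[tT ->]].
  by case/andP=> /tableau2_entry tT /eqP.
rewrite eqxx andbT; apply: (increasing_tableau2 n_gt0 tT) => r c.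
by rewrite entry_cell.
Qed.

Lemma eq_entry (T : filling [:: n; n]) M t : 0 < n -> tableau2 n M t ->
  (forall r c, T (cell r c) = t r c) -> entry T =2 t.
Proof.
move=> n_gt0 tT TE r c; have [lt_cn|le_nc] := ltnP c n.
  by rewrite (entry_cell _ _ (Ordinal lt_cn)) TE.
by rewrite entry_default // (max_entry_tableau2 n_gt0 tT TE) (row_end tT).
Qed.

End Boxes.

Arguments cell : simpl never.

Section SlidingStep.
Local Open Scope nat_scope.
Variable n : nat.
Implicit Types (S : partial_filling [:: n; n]) (G : bool -> nat -> option nat).

Local Notation omin := (oAC minnA minnC).

Lemma seq_min_big (s : seq nat) :
  seq_min s = \big[omin/None]_(x <- s) Some x.
Proof.
case: s => [|x s]; first by rewrite big_nil.
rewrite big_cons /=; elim: s => [|y s IHs];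
  first by rewrite big_nil Monoid.mulm1.
by rewrite big_cons Monoid.mulmCA /= -IHs.
Qed.

Lemma SE_min_label_big S b :
  SE_min_label S b = \big[omin/None]_(b' | SE_neighbor b b') S b'.
Proof.
rewrite /SE_min_label seq_min_big.
have -> : \big[omin/None]_(b' | SE_neighbor b b') S b' =
    \big[omin/None]_(b' <- enum {: box [:: n; n]} | SE_neighbor b b') S b'.
  by rewrite big_enum_cond.
rewrite -[RHS]big_filter.
elim: (filter _ _) => [|b' s IHs] /=; first by rewrite !big_nil.
by rewrite [RHS]big_cons; case: (S b') => [x|] /=;
  rewrite ?big_cons IHs ?Monoid.mul1m.
Qed.

Definition label S (r : bool) (c : nat) : option nat :=
  obind (fun o => S (cell r o)) (insub c).

Lemma label_cell S r (c : 'I_n) : label S r c = S (cell r c).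
Proof. by rewrite /label valK. Qed.

Lemma label_default S r c : n <= c -> label S r c = None.
Proof. by move=> le_nc; rewrite /label insubN // -leqNgt. Qed.

Lemma big_right_neighbor S r (c : 'I_n) :
  \big[omin/None]_(b | SE_neighbor (cell r c) b && (brow b == r)) S b =
    label S r c.+1.
Proof.
have right_cell r' (c' : 'I_n) : SE_neighbor (cell r c) (cell r' c') &&
    (brow (cell r' c') == r) = (r' == r) && (c' == c.+1 :> nat).
  by rewrite SE_neighbor_cell brow_cell; case: r r' => [] [] //=;
    rewrite ?andbT ?andbF.
case: (ltnP c.+1 n) => [lt_c1n|le_nc1]; last first.
  rewrite label_default // big1 // => b; elim/cell_ind: b => r' c'.
  by rewrite right_cell => /andP[_ /eqP E]; have := ltn_ord c'; lia.
rewrite (label_cell S r (Ordinal lt_c1n)); apply: big_pred1.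
by apply: cell_ind => r' c'; rewrite right_cell /= cell_eqE -val_eqE.
Qed.

Definition min_label G (r : bool) (c : nat) : option nat :=
  omin (if r then None else G true c) (G r c.+1).

Lemma SE_min_label_cell S r (c : 'I_n) :
  SE_min_label S (cell r c) = min_label (label S) r c.
Proof.
rewrite SE_min_label_big (bigID (fun b => brow b == r)) /= big_right_neighbor.
rewrite Monoid.mulmC; congr omin; case: r; rewrite ?label_cell.
  apply: big1 => b; elim/cell_ind: b => r' c'.
  by rewrite SE_neighbor_cell brow_cell; case: r'; rewrite /= ?andbF.
apply: big_pred1; apply: cell_ind => r' c' /=.
by rewrite SE_neighbor_cell brow_cell cell_eqE; case: r' => /=;
  rewrite ?andbF ?orbF ?andbT.
Qed.

Definition takes G (r : bool) (c x : nat) : bool :=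
  (G r c == None) && (min_label G r c == Some x).

Definition label_step G (r : bool) (c : nat) : option nat :=
  if G r c is Some x then
    if (0 < c) && takes G r c.-1 x || r && takes G false c x then None
    else Some x
  else min_label G r c.

Lemma promotion_step_cell S r (c : 'I_n) :
  promotion_step S (cell r c) = label_step (label S) r c.
Proof.
rewrite ffunE /label_step label_cell -SE_min_label_cell.
case: (S (cell r c)) => // x; congr (if _ then _ else _).
apply/existsP/orP => [[b]|]; last first.
  have takes_cell r' (c' : 'I_n) : takes (label S) r' c' x ->
      SE_neighbor (cell r' c') (cell r c) ->
      exists b, [&& S b == None, SE_neighbor b (cell r c)
                  & SE_min_label S b == Some x].
    move=> /andP[empty min_x] nb; exists (cell r' c').
    by rewrite -label_cell empty nb SE_min_label_cell.
  case=> /andP[]; last first.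
    by move=> r1 /takes_cell; apply; rewrite SE_neighbor_cell r1 eqxx.
  move=> c_gt0; have lt_c1n : c.-1 < n by have := ltn_ord c; lia.
  move/(takes_cell _ (Ordinal lt_c1n)); apply.
  by rewrite SE_neighbor_cell eqxx /= prednK // eqxx orbT.
elim/cell_ind: b => r' c';
  rewrite SE_neighbor_cell SE_min_label_cell -label_cell.
case/and3P=> empty nb min_x; have {empty min_x} : takes (label S) r' c' x.
  by rewrite /takes empty.
case/orP: nb => [/and3P[/negPf-> -> /eqP->]|/andP[/eqP-> /eqP->]] takes_x.
  by right.
by left.
Qed.

End SlidingStep.

Section Kpromotion.
Local Open Scope nat_scope.
Variables (n : nat) (T : filling [:: n; n]).

Local Notation M := (max_entry T).
Local Notation t := (entry T).
Local Notation touch := (gap_col n t true).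
Local Notation drop := (gap_col n t false).
Local Notation slide := (slide n t).

Hypotheses (n_gt0 : 0 < n) (tT : tableau2 n M t).
Implicit Types (r : bool) (s c x : nat).

(* After s sliding steps the empty boxes lie on the antidiagonal of index s,
   except for the last box, which stays empty once it has been reached. *)
Definition empty_at (s : nat) (r : bool) (c : nat) : bool :=
  (c + r == s) && (if r then touch <= c else c <= drop) ||
  [&& r, c.+1 == n & n <= s].

Definition slide_state (s : nat) (r : bool) (c : nat) : option nat :=
  if (n <= c) || empty_at s r c then None
  else Some (if c + r < s then slide r c else t r c).

Lemma slide_stateE s r c : c < n -> slide_state s r c =
  if empty_at s r c then None
  else Some (if c + r < s then slide r c else t r c).
Proof. by move=> lt_cn; rewrite /slide_state leqNgt lt_cn. Qed.

Lemma slide_state_default s r c : n <= c -> slide_state s r c = None.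
Proof. by move=> le_nc; rewrite /slide_state le_nc. Qed.

Lemma min_label_slide_state s r c : c < n -> c + r = s ->
  (if r then touch <= c else c <= drop) ->
  min_label (slide_state s) r c =
    if r && (c.+1 == n) then None else Some (slide r c).
Proof.
move=> lt_cn <-; rewrite /min_label /slide_state /empty_at /slide.
have [lt_drop gap_drop drop_min] := gap_col_spec n_gt0 tT false.
case: r => /= [le_c|le_c].
  rewrite [c < touch]ltnNge le_c /=; case: (ltngtP c.+1 n) lt_cn => // lt_c1n _.
  by rewrite !ifF //; lia.
have -> : (n <= c) || ((c + 1 == c + 0) && (touch <= c) ||
    (c.+1 == n) && (n <= c + 0)) = false.
  by lia.
have -> : (c + 1 < c + 0) = false by lia.
have -> : (c.+1 + 0 < c + 0) = false by lia.
have -> : [|| n <= c.+1, (c.+1 + 0 == c + 0) && (c < drop) | false] =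
    (n <= c.+1).
  by lia.
move: le_c; rewrite leq_eqVlt => /predU1P[Ec|lt_c].
  rewrite Ec ltnn eqxx; case: ifP => _ //; rewrite oACE (minn_idPl _) //.
  by lia.
have := drop_min c lt_c; rewrite lt_c ifF ?oACE; last by lia.
by move=> le_t; rewrite (minn_idPr _) //; lia.
Qed.

Lemma takes_slide_state s r c x : c < n -> takes (slide_state s) r c x =
  [&& c + r == s, (if r then (touch <= c) && (c.+1 < n) else c <= drop)
    & x == slide r c].
Proof.
move=> lt_cn; rewrite /takes andbA.
have [on_path|off_path] :=
    boolP ((c + r == s) && (if r then touch <= c else c <= drop)).
  have [/eqP Es path_c] := andP on_path.
  rewrite min_label_slide_state // /slide_state /empty_at on_path orbT /=.
  case: r path_c Es {on_path} => /= -> ->; rewrite eqxx /=;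
    last by rewrite eq_sym.
  by rewrite [c.+1 < n]ltn_neqAle lt_cn andbT; case: (c.+1 =P n) => //= _;
    rewrite eq_sym.
have /negPf-> : ~~ ((c + r == s) &&
    (if r then (touch <= c) && (c.+1 < n) else c <= drop)).
  by apply: contra off_path; case: r => // /and3P[-> ->].
rewrite /slide_state /empty_at (negPf off_path) leqNgt lt_cn /=.
case: r {off_path} => //=; case: (c.+1 =P n) => //= Ec;
  rewrite /min_label Ec leqnn.
by rewrite Monoid.mul1m /= andbF.
Qed.

Lemma taken_slide_state s r c : c < n -> ~~ empty_at s r c ->
  let x := if c + r < s then slide r c else t r c in
  (0 < c) && takes (slide_state s) r c.-1 x ||
      r && takes (slide_state s) false c x =
    empty_at s.+1 r c.
Proof.
move=> lt_cn full x; rewrite !takes_slide_state //; last by lia.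
have [lt_drop gap_drop drop_min] := gap_col_spec n_gt0 tT false.
have [lt_touch gap_touch touch_min] := gap_col_spec n_gt0 tT true.
have le_td := touch_le_drop n_gt0 tT; rewrite /x /slide /empty_at.
case: r full {x} => /= full; last first.
  case: c {lt_cn full} => [|c] //=; rewrite !addn0 ?eqSS orbF.
  case: eqVneq => [->|] //=; rewrite ltnNge leqnSn /=.
  by case: (ltngtP s drop) => //= [_|->]; [rewrite eqxx | lia].
have -> : (c.+1 == n) && (n <= s.+1) = (c.+1 == n) && (c == s).
  by move: full; rewrite /empty_at /=; lia.
have [Ecs|ne_cs] := eqVneq c s; last first.
  by case: c ne_cs {lt_cn full} => [|c] ne_cs;
    rewrite /= ?addn0 !addn1 ?eqSS (negPf ne_cs) /= ?andbF.
rewrite -Ecs addn0 !addn1 !eqxx [c.+1 < c]ltnNge leqnSn /= andbT.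
rewrite (_ : (touch <= c) || (c.+1 == n) = (touch <= c)); last by lia.
case: (ltngtP c touch) => [lt_c|lt_c|Ec].
- have := touch_min c lt_c; have lt_cd := leq_trans lt_c le_td.
  by rewrite lt_cd /=; lia.
- have c_gt0 : 0 < c by lia.
  by rewrite prednK // ifF ?eqxx; lia.
rewrite Ec le_td; case: (ltngtP touch drop) le_td => //= [lt_td|Etd] _.
  have le_t := drop_min touch lt_td.
  by rewrite (_ : t true touch == t false touch.+1) ?orbT //; lia.
by rewrite eqxx orbT.
Qed.

Lemma label_step_slide_state s r c :
  c < n -> label_step (slide_state s) r c = slide_state s.+1 r c.
Proof.
move=> lt_cn; rewrite /label_step !slide_stateE //.
have [empty|full] := boolP (empty_at s r c).
  case/orP: empty => [/andP[/eqP<- path_c]|/and3P[-> /eqP Ec le_ns]].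
  - rewrite min_label_slide_state // ltnSn.
    rewrite (_ : empty_at (c + r).+1 r c = r && (c.+1 == n)) //.
    by rewrite /empty_at; case: r {path_c} => /=; lia.
  - rewrite /min_label Monoid.mul1m slide_state_default ?Ec //.
    by rewrite /empty_at Ec eqxx (leqW le_ns) orbT.
rewrite (taken_slide_state lt_cn full); case: ifP => // _; congr Some.
rewrite ltnS [c + r <= s]leq_eqVlt; case: (c + r =P s) => //= Es.
move: full; rewrite Es ltnn /empty_at Es eqxx /= negb_or => /andP[off_path _].
rewrite /slide.
by case: r off_path {Es} => /= off_path; case: ltngtP off_path.
Qed.

Lemma label_iter_promotion_step s :
  label (iter s (@promotion_step _) (delete_one T)) =2 slide_state s.
Proof.
elim: s => [|s IHs] r c; have [lt_cn|le_nc] := ltnP c n.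
- rewrite (label_cell _ r (Ordinal lt_cn)) ffunE -entry_cell slide_stateE //=.
  rewrite (_ : empty_at 0 r c = (t r c == 1)) //.
  have first1 := first_entry n_gt0 tT; have gt0 := entries_gt0 tT false lt_cn.
  have := col_lt tT lt_cn; have := @row_incr _ _ _ tT false 0 c.
  rewrite /empty_at.
  by case: r => /=; [lia | case: (posnP c) => [->|]; rewrite ?first1 /=; lia].
- by rewrite label_default // slide_state_default.
- rewrite (label_cell _ r (Ordinal lt_cn)) promotion_step_cell.
  by rewrite -label_step_slide_state // /label_step /takes /min_label !IHs.
- by rewrite label_default // slide_state_default.
Qed.

Lemma Kpromotion_cell r (c : 'I_n) : Kpromotion T (cell r c) = promote n t r c.
Proof.
rewrite ffunE /promotion_slide card_box2 -label_cell label_iter_promotion_step.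
have lt_cn := ltn_ord c; rewrite slide_stateE // /promote lt_cn.
rewrite (_ : c + r < 2 * n); last by case: r; lia.
congr _.-1; case: ifP => //=.
have [lt_drop _ _] := gap_col_spec n_gt0 tT false.
rewrite /empty_at; case: r => /= [last_c|]; last by lia.
have -> : nat_of_ord c = n.-1 by lia.
by rewrite -[LHS](slide_last n_gt0 tT).
Qed.

Lemma entry_Kpromotion : entry (Kpromotion T) =2 promote n t.
Proof. exact: eq_entry (tableau2_promote n_gt0 tT) Kpromotion_cell. Qed.

Lemma increasing_Kpromotion : increasing_tableau (Kpromotion T).
Proof.
exact: increasing_tableau2 (tableau2_promote n_gt0 tT) Kpromotion_cell.
Qed.

Lemma max_entry_Kpromotion : max_entry (Kpromotion T) = M.
Proof.
exact: max_entry_tableau2 (tableau2_promote n_gt0 tT) Kpromotion_cell.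
Qed.

End Kpromotion.

Section Kevacuation.
Local Open Scope nat_scope.
Variable n : nat.

Definition rotate (T : filling [:: n; n]) : filling [:: n; n] :=
  [ffun b => (max_entry T).+1 - entry T (brow b == 0) (n.-1 - bcol b)].

Lemma rotate_cell T r (c : 'I_n) :
  rotate T (cell r c) = (max_entry T).+1 - entry T (~~ r) (n.-1 - c).
Proof. by rewrite ffunE brow_cell bcol_cell; case: r. Qed.

Hypothesis n_gt0 : 0 < n.

Section RotateTableau2.
Variables (M : nat) (t : bool -> nat -> nat).
Hypothesis tT : tableau2 n M t.

Definition rotate_rows (r : bool) (c : nat) : nat :=
  if c < n then M.+1 - t (~~ r) (n.-1 - c) else M.+1.

Lemma occurs_rotate_rows r v : 0 < v <= M ->
  occurs n (rotate_rows r) v = occurs n (t (~~ r)) (M.+1 - v).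
Proof.
move=> v_in; apply/occursP/occursP => -[c lt_cn tc].
  exists (n.-1 - c); first by lia.
  by move: tc; rewrite /rotate_rows lt_cn; lia.
have lt_c'n : n.-1 - c < n by lia.
exists (n.-1 - c) => //; rewrite /rotate_rows lt_c'n subKn ?tc; lia.
Qed.

Lemma tableau2_rotate_rows : tableau2 n M rotate_rows.
Proof.
have bounds r c : c < n -> 0 < t r (n.-1 - c) <= M.
  by move=> lt_cn; rewrite (entries_gt0 tT) ?(entries_le tT); lia.
rewrite /rotate_rows; split=>
  [r i j lt_ij lt_jn1|c lt_cn|r c lt_cn|r c le_nc|v v_in].
- have lt_in : i < n by lia.
  have := bounds (~~ r) i lt_in; rewrite lt_in; case: ifP => lt_jn; last by lia.
  have := bounds (~~ r) j lt_jn.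
  by have := @row_incr _ _ _ tT (~~ r) (n.-1 - j) (n.-1 - i); lia.
- have := bounds true c lt_cn; have := @col_lt _ _ _ tT (n.-1 - c).
  by rewrite lt_cn /=; lia.
- by rewrite lt_cn; have := bounds (~~ r) c lt_cn; lia.
- by rewrite ltnNge le_nc.
by rewrite !occurs_rotate_rows // orbC (entries_onto tT) //; lia.
Qed.

End RotateTableau2.

Section IncreasingTableau.
Variable T : filling [:: n; n].
Hypothesis incT : increasing_tableau T.

Local Notation M := (max_entry T).
Local Notation promotions i := (iter i (@Kpromotion [:: n; n]) T).

Lemma iter_Kpromotion i :
  [/\ increasing_tableau (promotions i), max_entry (promotions i) = M
    & entry (promotions i) =2 iter i (promote n) (entry T)].
Proof.
elim: i => [|i [inc_i max_i entry_i]] //=; have t'T := tableau2_entry inc_i.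
split; first exact: increasing_Kpromotion.
  by rewrite max_entry_Kpromotion.
by move=> r c; rewrite entry_Kpromotion // (eq_promote _ entry_i).
Qed.

Lemma mem_boxes_le_Kpromotion i r (c : 'I_n) : i <= M ->
  (cell r c \in boxes_le (promotions i) (M - i)) =
    (i < entry T (~~ r) (n.-1 - c)).
Proof.
move=> le_iM; have tT := tableau2_entry incT.
have [_ _ entry_i] := iter_Kpromotion i.
have [t'T _] := rectifies_iter_promote n_gt0 tT i.
have lt_cn := ltn_ord c; have lt_c'n : n.-1 - c < n by lia.
rewrite inE -entry_cell entry_i -(ltn_count_le _ (row_incr t'T r)) //.
have := @ltn_count_le n (entry T (~~ r)) i _ (row_incr tT _) lt_c'n.
by have := count_le_iter_promote n_gt0 tT r le_iM; lia.
Qed.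

Lemma Kevacuation_rotate : Kevacuation T = rotate T.
Proof.
have tT := tableau2_entry incT.
apply/ffunP; apply: cell_ind => r c; rewrite ffunE rotate_cell.
have lt_c'n : n.-1 - c < n by have := ltn_ord c; lia.
have := entries_le tT (~~ r) lt_c'n; have := entries_gt0 tT (~~ r) lt_c'n.
have memE j : j <= M -> (cell r c \in boxes_le (promotions (M - j)) j) =
    (M - j < entry T (~~ r) (n.-1 - c)).
  by move=> le_jM; rewrite -mem_boxes_le_Kpromotion ?leq_subr // subKn.
move: (entry T _ _) memE => e memE e_gt0 le_eM.
have lt_eM : M.+1 - e < M.+1 by lia.
case: pickP => [j /=|/(_ (Ordinal lt_eM))] /=.
  by case/andP=> j_gt0; rewrite inE !memE; have := ltn_ord j; lia.
by rewrite inE !memE; lia.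
Qed.

End IncreasingTableau.

Section RotateInc.
Variables (k : nat) (T : filling [:: n; n]).
Hypothesis IncT : is_Inc k T.

Let incT : increasing_tableau T.
Proof. by case/andP: IncT. Qed.

Let rotateE r (c : 'I_n) :
  rotate T (cell r c) = rotate_rows (max_entry T) (entry T) r c.
Proof. by rewrite rotate_cell /rotate_rows ltn_ord. Qed.

Let rotateT := tableau2_rotate_rows (tableau2_entry incT).

Lemma max_entry_rotate : max_entry (rotate T) = max_entry T.
Proof. exact: max_entry_tableau2 n_gt0 rotateT rotateE. Qed.

Lemma entry_rotate : entry (rotate T) =2 rotate_rows (max_entry T) (entry T).
Proof. exact: eq_entry n_gt0 rotateT rotateE. Qed.

Lemma rotate_Inc : is_Inc k (rotate T).
Proof.
case/andP: IncT => _ maxT; rewrite /is_Inc max_entry_rotate maxT andbT.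
exact: increasing_tableau2 n_gt0 rotateT rotateE.
Qed.

Lemma rotateK : rotate (rotate T) = T.
Proof.
apply/ffunP; apply: cell_ind => r c; have lt_cn := ltn_ord c.
have lt_c'n : n.-1 - c < n by lia.
rewrite rotate_cell max_entry_rotate entry_rotate /rotate_rows lt_c'n negbK.
have -> : n.-1 - (n.-1 - c) = c by lia.
by rewrite subKn ?entry_cell // -entry_cell leqW // entry_le_max.
Qed.

End RotateInc.

End Kevacuation.

(** * Words of tableaux *)

(* A letter tells in which of the two rows a value occurs.  Words list the
   letters of a tableau from the largest value down, so that the tail of a word
   is the word of the subtableau of smaller values. *)
Local Notation letter := (bool * bool)%type.

Section Words.
Local Open Scope nat_scope.

Implicit Types (x : letter) (w : seq letter) (r : bool) (e h k v l : nat).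

Definition in_row r x : bool := if r then x.2 else x.1.

Definition letters : seq letter :=
  [:: (true, false); (false, true); (true, true)].

Definition letter_at w v : letter := nth (false, false) w (size w - v).

Definition doubles w : nat := count_mem (true, true) w.

Definition step x h : option nat :=
  if x.2 <= h then Some (h - x.2 + x.1) else None.

Definition run w h : option nat := foldr (fun x => obind (step x)) (Some h) w.

Definition dyck_word h k w : bool := (run w 0 == Some h) && (doubles w == k).

Definition dyck_prefix e k w : bool :=
  oapp (leq e) false (run w 0) && (doubles w == k).

Fixpoint words l : seq (seq letter) :=
  if l is l'.+1 then [seq x :: w | x <- letters, w <- words l'] else [:: [::]].

Lemma mem_words l w : (w \in words l) = (size w == l) && all (mem letters) w.
Proof.
elim: l w => [|l IHl] [|x w]; rewrite ?inE //.
  by apply/negbTE/allpairsP => -[p []].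
rewrite eqSS [all _ _]/= andbCA -IHl.
apply/allpairsP/andP => [[[y u] [y_in u_in [-> ->]]]|]; first by split.
by case=> x_in w_in; exists (x, w).
Qed.

Lemma uniq_words l : uniq (words l).
Proof.
elim: l => // l IHl; rewrite allpairs_uniq //.
by move=> [x u] [y w] _ _ [-> ->].
Qed.

Lemma eq_letter_at w1 w2 : size w1 = size w2 ->
  (forall v, 0 < v <= size w1 -> letter_at w1 v = letter_at w2 v) -> w1 = w2.
Proof.
move=> eq_sz eq_w; apply: (@eq_from_nth _ (false, false)) => // i lt_i.
by have := eq_w (size w1 - i); rewrite /letter_at -eq_sz subKn ?(ltnW lt_i) //;
  apply; lia.
Qed.

Lemma letter_at_cons x w v :
  letter_at (x :: w) v = if v <= size w then letter_at w v else x.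
Proof.
rewrite /letter_at /=; case: leqP => [le_v|lt_v]; first by rewrite subSn.
by rewrite (_ : _ - v = 0) //; lia.
Qed.

Lemma run_cat w1 w2 h : run (w1 ++ w2) h = obind (run w1) (run w2 h).
Proof.
rewrite /run foldr_cat; case: (foldr _ _ w2) => //=.
by elim: w1 => //= x w ->.
Qed.

Lemma run_count w h h' :
  run w h = Some h' -> h + count (in_row false) w = h' + count (in_row true) w.
Proof.
elim: w h' => [|x w IHw] h' /=; first by case=> ->.
case: (run w h) IHw => //= h'' /(_ _ erefl); rewrite /step.
by case: ifP => // le_x ? [<-]; case: x le_x => [] [] [] /=; lia.
Qed.

Lemma count_in_rows w : all (mem letters) w ->
  count (in_row false) w + count (in_row true) w = size w + doubles w.
Proof.
rewrite /doubles; elim: w => //= x w IHw /andP[x_in /IHw].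
by case: x x_in => [] [] [] //=; lia.
Qed.

Definition swap x : letter := (x.2, x.1).

Lemma swapK : involutive swap.
Proof. by case. Qed.

Lemma step_swap x h h' : step x h = Some h' -> step (swap x) h' = Some h.
Proof.
by rewrite /step; case: ifP => // le_x [<-];
  rewrite /= ifT ?addnK ?subnK ?leq_addl.
Qed.

Definition flip w : seq letter := map swap (rev w).

Lemma size_flip w : size (flip w) = size w.
Proof. by rewrite size_map size_rev. Qed.

Lemma flip_cat w1 w2 : flip (w1 ++ w2) = flip w2 ++ flip w1.
Proof. by rewrite /flip rev_cat map_cat. Qed.

Lemma flipK : involutive flip.
Proof. by move=> w; rewrite /flip -map_rev revK (mapK swapK). Qed.

Lemma all_flip w : all (mem letters) (flip w) = all (mem letters) w.
Proof. by rewrite all_map all_rev; apply: eq_all => -[[] []]. Qed.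

Lemma doubles_flip w : doubles (flip w) = doubles w.
Proof.
by rewrite /doubles count_map count_rev; apply: eq_count => -[[] []].
Qed.

Lemma run_flip w h h' : run w h = Some h' -> run (flip w) h' = Some h.
Proof.
elim: w h' => [|x w IHw] h' /=; first by case=> ->.
case: (run w h) IHw => //= h'' IHw /step_swap step_x.
by rewrite -cat1s flip_cat run_cat (_ : run _ h' = Some h'') //= IHw.
Qed.

Lemma letter_at_flip w v : 0 < v <= size w ->
  letter_at (flip w) v = swap (letter_at w ((size w).+1 - v)).
Proof.
move=> v_in; rewrite /letter_at size_flip (nth_map (false, false)) ?size_rev;
  last by lia.
by rewrite nth_rev; [congr (swap (nth _ _ _)) | ]; lia.
Qed.

Definition positions r w : seq nat :=
  [seq v <- iota 1 (size w) | in_row r (letter_at w v)].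

Lemma mem_positions r w v :
  (v \in positions r w) = (0 < v <= size w) && in_row r (letter_at w v).
Proof. by rewrite mem_filter mem_iota add1n ltnS andbC. Qed.

Lemma positions_sorted r w : sorted ltn (positions r w).
Proof. exact: sorted_filter ltn_trans _ _ (iota_ltn_sorted _ _). Qed.

Lemma positions_cons r x w : positions r (x :: w) =
  if in_row r x then rcons (positions r w) (size w).+1 else positions r w.
Proof.
rewrite /positions [X in iota 1 X]/= -[X in iota 1 X]addn1 iotaD filter_cat.
rewrite (_ : [seq v <- iota 1 (size w) | _] = positions r w); last first.
  by apply: eq_in_filter => v; rewrite mem_iota letter_at_cons => v_in;
    rewrite ifT //; lia.
by rewrite /= letter_at_cons add1n ltnn; case: ifP;
  rewrite ?cats1 ?cats0 // addn1.
Qed.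

Lemma size_positions r w : size (positions r w) = count (in_row r) w.
Proof.
by elim: w => //= x w IHw; rewrite positions_cons; case: ifP;
  rewrite ?size_rcons IHw.
Qed.

Lemma nth_positions_bounds r w v0 c : c < count (in_row r) w ->
  0 < nth v0 (positions r w) c <= size w.
Proof.
rewrite -size_positions => /(mem_nth v0).
by rewrite mem_positions => /andP[].
Qed.

Lemma positions_col_lt w v0 h : run w 0 = Some h ->
  forall c, c < count (in_row true) w ->
  nth v0 (positions false w) c < nth v0 (positions true w) c.
Proof.
elim: w h => //= x w IHw h'; case: (run w 0) (@run_count w 0) IHw => //= h.
move=> /(_ _ erefl) countE /(_ _ erefl) IHw; rewrite /step.
case: ifP => // le_xh _ c.
rewrite !positions_cons.
have nth_lt d : d < count (in_row false) w ->
    nth v0 (positions false w) d < (size w).+1.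
  by move/(nth_positions_bounds v0)/andP=> [].
case: x le_xh => [x0 x1] /= le_xh lt_c.
have lt_c0 : c < count (in_row false) w by lia.
have -> : nth v0 (if x0 then rcons (positions false w) (size w).+1
                  else positions false w) c = nth v0 (positions false w) c.
  by case: x0; rewrite // nth_rcons size_positions lt_c0.
case: x1 le_xh lt_c => le_xh /=; last exact: IHw.
rewrite add1n ltnS leq_eqVlt nth_rcons size_positions => /predU1P[Ec|lt_c].
  by rewrite Ec ltnn eqxx -Ec nth_lt.
by rewrite lt_c IHw.
Qed.

Definition word_of (P : bool -> pred nat) l : seq letter :=
  [seq (P false v, P true v) | v <- rev (iota 1 l)].

Lemma size_word_of P l : size (word_of P l) = l.
Proof. by rewrite size_map size_rev size_iota. Qed.

Lemma letter_at_word_of P l v :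
  0 < v <= l -> letter_at (word_of P l) v = (P false v, P true v).
Proof.
move=> v_in; rewrite /letter_at size_word_of (nth_map 0) ?size_rev ?size_iota;
  last by lia.
by rewrite nth_rev ?size_iota ?nth_iota; [congr (P _ _, P _ _) | |]; lia.
Qed.

Lemma word_ofS P l : word_of P l.+1 =
  (P false l.+1, P true l.+1) :: word_of P l.
Proof. by rewrite /word_of -{1}[l.+1]addn1 iotaD rev_cat add1n. Qed.

Lemma mem_positions_word_of P r l v :
  (v \in positions r (word_of P l)) = (0 < v <= l) && P r v.
Proof.
rewrite mem_positions size_word_of; apply: andb_id2l => v_in.
by rewrite letter_at_word_of //; case: r.
Qed.

Lemma flip_word_of P l :
  flip (word_of P l) = word_of (fun r v => P (~~ r) (l.+1 - v)) l.
Proof.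
apply: eq_letter_at => [|v]; rewrite size_flip !size_word_of // => v_in.
by rewrite letter_at_flip size_word_of // !letter_at_word_of //; lia.
Qed.

Lemma word_of_positions w : word_of (fun r => mem (positions r w)) (size w) = w.
Proof.
apply: eq_letter_at => [|v]; rewrite size_word_of // => v_in.
by rewrite letter_at_word_of //= !mem_positions v_in /= -surjective_pairing.
Qed.

Lemma eq_word_of P Q l : (forall r v, 0 < v <= l -> P r v = Q r v) ->
  word_of P l = word_of Q l.
Proof.
move=> PQ; apply/eq_in_map => v; rewrite mem_rev mem_iota add1n ltnS => v_in.
by rewrite !PQ.
Qed.

End Words.

Section TableauWord.
Local Open Scope nat_scope.
Variable n : nat.
Hypothesis n_gt0 : 0 < n.
Implicit Types (T : filling [:: n; n]) (w : seq letter) (r : bool).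

Definition word T : seq letter :=
  word_of (fun r => occurs n (entry T r)) (max_entry T).

Definition rows_of w r (c : nat) : nat := nth (size w).+1 (positions r w) c.

Definition tableau_of w : filling [:: n; n] :=
  [ffun b => rows_of w (brow b == 1) (bcol b)].

Lemma tableau_of_cell w r (c : 'I_n) : tableau_of w (cell r c) = rows_of w r c.
Proof. by rewrite ffunE brow_cell bcol_cell; case: r. Qed.

Section WordOfRows.
Variables (M : nat) (t : bool -> nat -> nat).
Hypothesis tT : tableau2 n M t.

Local Notation word_t l := (word_of (fun r => occurs n (t r)) l).

Lemma run_word_of l : run (word_t l) 0 = Some (height n t l).
Proof.
elim: l => [|l IHl]; first by rewrite /height !(row_count0 tT).
rewrite word_ofS /= -/(run _ _) IHl /= /step /=
  (height_down n_gt0 tT) leq_addl addnK.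
by rewrite -(height_up n_gt0 tT).
Qed.

Lemma positions_word_of r :
  positions r (word_t M) = [seq t r c | c <- iota 0 n].
Proof.
apply: (irr_sorted_eq ltn_trans ltnn); first exact: positions_sorted.
  apply/(sortedP 0) => c; rewrite size_map size_iota => lt_c1n.
  by rewrite !(nth_map 0) ?size_iota ?nth_iota ?(row_incr tT) // ltnW.
move=> v; rewrite mem_positions_word_of; apply/andP/mapP => [[_ /occursP]|].
  by case=> c lt_cn tc; exists c; rewrite ?mem_iota.
case=> c; rewrite mem_iota => lt_cn ->.
rewrite (entries_gt0 tT) // (entries_le tT) //; split=> //.
by apply/occursP; exists c.
Qed.

Lemma letters_word_of : all (mem letters) (word_t M).
Proof.
apply/allP => x /mapP[v].
rewrite mem_rev mem_iota add1n ltnS => /(entries_onto tT).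
by move=> occ ->; case: (occurs _ _ _) (occurs _ _ _) occ => [] [].
Qed.

Lemma doubles_word_of : M + doubles (word_t M) = 2 * n.
Proof.
have := count_in_rows letters_word_of.
rewrite size_word_of -!size_positions !positions_word_of.
by rewrite !size_map size_iota; lia.
Qed.

End WordOfRows.

Section RowsOfWord.
Variable w : seq letter.
Hypotheses (w_letters : all (mem letters) w) (w_run : run w 0 = Some 0)
           (w_count : forall r, count (in_row r) w = n).

Lemma rows_of_default r c : n <= c -> rows_of w r c = (size w).+1.
Proof.
by move=> le_nc; rewrite /rows_of nth_default // size_positions w_count.
Qed.

Lemma occurs_rows_of r v : occurs n (rows_of w r) v = (v \in positions r w).
Proof.
apply/occursP/(nthP (size w).+1); rewrite size_positions w_count => -[c];
  by exists c.
Qed.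

Lemma rows_of_bounds r c : c < n -> 0 < rows_of w r c <= size w.
Proof. by move=> lt_cn; apply: nth_positions_bounds; rewrite w_count. Qed.

Lemma tableau2_rows_of : tableau2 n (size w) (rows_of w).
Proof.
split=> [r i j lt_ij|c lt_cn|r c lt_cn|r c le_nc|v v_in].
- rewrite ltnS leq_eqVlt => /predU1P[Ej|lt_jn].
    rewrite [rows_of w r j]rows_of_default ?Ej // ltnS.
    by have /andP[] := @rows_of_bounds r i ltac:(lia).
  apply: (sorted_ltn_nth ltn_trans);
    rewrite ?inE ?positions_sorted // size_positions w_count //.
  exact: ltn_trans lt_jn.
- by apply: (positions_col_lt _ w_run); rewrite w_count.
- by have /andP[] := rows_of_bounds r lt_cn.
- exact: rows_of_default.
rewrite !occurs_rows_of !mem_positions v_in /=.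
have [v_gt0 le_v] := andP v_in; have : letter_at w v \in letters.
  by apply: (allP w_letters);
    rewrite mem_nth // ltn_subrL v_gt0 (leq_trans v_gt0).
by case: (letter_at w v) => [] [] [].
Qed.

Lemma word_tableau_of : word (tableau_of w) = w.
Proof.
have rowsE := tableau_of_cell w; have tT := tableau2_rows_of.
rewrite /word (max_entry_tableau2 n_gt0 tT rowsE) -[RHS]word_of_positions.
apply: eq_word_of => r v _ /=; rewrite -occurs_rows_of.
by apply: eq_has => c; rewrite (eq_entry n_gt0 tT rowsE).
Qed.

End RowsOfWord.

Section IncWords.
Variable k : nat.

Lemma word_dyck T : is_Inc k T ->
  word T \in words (2 * n - k) /\ dyck_word 0 k (word T).
Proof.
case/(is_Inc_tableau2 _ _ n_gt0) => tT EM; have doublesE := doubles_word_of tT.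
rewrite mem_words (letters_word_of tT) size_word_of /dyck_word (run_word_of tT).
by rewrite /height !(row_count_max tT) subnn eqxx -/(word T) in doublesE *;
  split; lia.
Qed.

Lemma tableau_of_word T : is_Inc k T -> tableau_of (word T) = T.
Proof.
case/(is_Inc_tableau2 _ _ n_gt0) => tT _; apply/ffunP; apply: cell_ind => r c.
rewrite tableau_of_cell /rows_of (positions_word_of tT)
  (nth_map 0) ?size_iota //.
by rewrite nth_iota // entry_cell.
Qed.

Lemma word_rotate T : is_Inc k T -> word (rotate T) = flip (word T).
Proof.
move=> IncT; have /(is_Inc_tableau2 _ _ n_gt0)[tT _] := IncT.
rewrite flip_word_of /word (max_entry_rotate n_gt0 IncT).
apply: eq_word_of => r v v_in.
rewrite -(occurs_rotate_rows n_gt0) //.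
by apply: eq_has => c; rewrite (entry_rotate n_gt0 IncT).
Qed.

Hypothesis le_k2n : k <= 2 * n.

Lemma count_dyck_word w : w \in words (2 * n - k) -> dyck_word 0 k w ->
  [/\ all (mem letters) w, run w 0 = Some 0 & forall r, count (in_row r) w = n].
Proof.
rewrite mem_words => /andP[/eqP size_w all_w] /andP[/eqP run_w /eqP doubles_w].
have := run_count run_w; have := count_in_rows all_w.
by split=> // -[]; lia.
Qed.

Lemma tableau_of_dyck w : w \in words (2 * n - k) -> dyck_word 0 k w ->
  is_Inc k (tableau_of w) /\ word (tableau_of w) = w.
Proof.
move=> w_in dyck_w; have [all_w run_w count_w] := count_dyck_word w_in dyck_w.
split; last exact: word_tableau_of.
have tT := tableau2_rows_of all_w run_w count_w.
have rowsE := tableau_of_cell w.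
rewrite /is_Inc (increasing_tableau2 n_gt0 tT rowsE)
  (max_entry_tableau2 n_gt0 tT rowsE).
by move: w_in; rewrite mem_words card_box2 => /andP[/eqP-> _]; apply/eqP; lia.
Qed.

End IncWords.
End TableauWord.

(** * Enumeration *)

Section PathCounts.
Local Open Scope nat_scope.
Implicit Types (l h k e : nat).

Definition npaths l h k : nat := count (dyck_word h k) (words l).

Definition nprefixes e l k : nat := count (dyck_prefix e k) (words l).

Lemma count_wordsS (P : pred (seq letter)) l : count P (words l.+1) =
  \sum_(x <- letters) count (fun w => P (x :: w)) (words l).
Proof. by rewrite !big_cons big_nil addn0 /= cats0 !count_cat !count_map. Qed.

Lemma npathsS l h k : npaths l.+1 h k =
  (if h is h'.+1 then npaths l h' k else 0) + npaths l h.+1 k +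
  (if (h, k) is (_.+1, k'.+1) then npaths l h k' else 0).
Proof.
rewrite /npaths count_wordsS !big_cons big_nil addn0 addnA /dyck_word.
congr (_ + _ + _).
- case: h => [|h]; [apply: eq_count0 | apply: eq_count] => w /=;
    by case: (run w 0) => //= g; rewrite /step subn0 addn1.
- by apply: eq_count => w /=; case: (run w 0) => [[|g]|] //=;
    rewrite /step /= subn1 addn0.
case: h => [|h]; [|case: k => [|k]].
- apply: eq_count0 => w /=; case: (run w 0) => [[|g]|] //=.
  by rewrite /step /= subn1 addn1.
- by apply: eq_count0 => w; rewrite /= andbF.
apply: eq_count => w /=; rewrite /doubles /= add1n eqSS.
by case: (run w 0) => [[|g]|] //=; rewrite /step /= subn1 addn1.
Qed.

Lemma nprefixesS l k : nprefixes 0 l.+1 k =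
  nprefixes 0 l k + nprefixes 1 l k +
  (if k is k'.+1 then nprefixes 1 l k' else 0).
Proof.
rewrite /nprefixes count_wordsS !big_cons big_nil addn0 addnA /dyck_prefix.
congr (_ + _ + _).
- by apply: eq_count => w /=; case: (run w 0).
- by apply: eq_count => w /=; case: (run w 0) => [[|g]|].
case: k => [|k].
  by apply: eq_count0 => w; rewrite /= andbF.
by apply: eq_count => w /=; rewrite /doubles /= add1n eqSS;
  case: (run w 0) => [[|g]|].
Qed.

Lemma nprefixes_npaths l k : nprefixes 0 l k = nprefixes 1 l k + npaths l 0 k.
Proof.
rewrite /nprefixes /npaths; elim: (words l) => //= w s ->.
by rewrite /dyck_prefix /dyck_word; case: (run w 0) => [[|g]|] //=; lia.
Qed.

Lemma npaths0 h k : npaths 0 h k = (h == 0) && (k == 0).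
Proof. by rewrite /npaths /= addn0 /dyck_word; case: h; case: k. Qed.

Lemma nprefixes0 e k : nprefixes e 0 k = (e == 0) && (k == 0).
Proof. by rewrite /nprefixes /= addn0 /dyck_prefix /= leqn0; case: k. Qed.

Lemma npaths_small l h k : l < h + k -> npaths l h k = 0.
Proof.
elim: l h k => [|l IHl] h k lt_l.
  by rewrite npaths0; case: h k lt_l => [|h] [].
rewrite npathsS (IHl h.+1); last by lia.
case: h lt_l => [|h] lt_l //; rewrite IHl; last by lia.
by case: k lt_l => // k lt_l; rewrite IHl //; lia.
Qed.

Lemma npaths_odd l h k : odd (l + h + k) -> npaths l h k = 0.
Proof.
elim: l h k => [|l IHl] h k odd_l.
  by rewrite npaths0; case: h k odd_l => [|h] [].
rewrite npathsS (IHl h.+1); last by lia.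
case: h odd_l => [|h] odd_l //; rewrite IHl; last by lia.
by case: k odd_l => // k odd_l; rewrite IHl //; lia.
Qed.

Lemma npaths_flat k : npaths k 0 k = (k == 0).
Proof.
case: k => [|k]; first by rewrite npaths0.
by rewrite npathsS npaths_small //; lia.
Qed.

Lemma nprefixes_flat (e : bool) l k :
  l <= k -> nprefixes e l k = [&& ~~ e, l == 0 & k == 0].
Proof.
elim: l k e => [|l IHl] k e le_lk; first by rewrite nprefixes0 eqb0.
case: k le_lk => // k le_lk; have := nprefixes_npaths l.+1 k.+1.
have := IHl k.+1 false (leqW le_lk); have := IHl k.+1 true (leqW le_lk).
have := IHl k true le_lk; case: e; rewrite nprefixesS !andbF /= => -> -> -> //.
by lia.
Qed.

Section ClosedForms.
Local Open Scope ring_scope.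
Variable R : realFieldType.

Local Ltac natr_neq0 := repeat (apply/andP; split); apply: lt0r_neq0;
  first [by rewrite ltr0n fact_gt0 | lra].

(* The value of [npaths] for u up steps, d down steps and k double letters,
   found by solving the recurrence [npathsS] extended to d = u + 1 with the
   boundary condition
   [path_formula (u - 1) u k + path_formula u u (k - 1) = 0]. *)
Definition path_formula (u d k : nat) : R :=
  (u + d + k)`!%:R / (u`!%:R * d`!%:R * k`!%:R) *
  (u%:R * (u + k).+1%:R - d%:R * (u + k)%:R) / ((u + k)%:R * (u + k).+1%:R).

(* The number of prefixes with k double letters and p + q + 1 other letters,
   where q <= p <= q + 1; those ending at height 0 are left out if e holds. *)
Definition prefix_formula (e : bool) (p q k : nat) : R :=
  (p + q + k).+1`!%:R /
    (p`!%:R * q`!%:R * k`!%:R * ((if e then p else q) + k).+1%:R).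

Let factS_natr m : m.+1`!%:R = (m%:R + 1) * m`!%:R :> R.
Proof. by rewrite factS natrM -natr1. Qed.

Lemma path_formula_rec u d k : path_formula u.+2 d k =
  path_formula u.+1 d k + (if d is d'.+1 then path_formula u.+2 d' k else 0) +
               (if k is k'.+1 then path_formula u.+2 d k' else 0).
Proof.
have u_ge0 := ler0n R u; case: d => [|d]; case: k => [|k];
  rewrite /path_formula ?(addnS, addSn, addn0) ?factS_natr -!natr1 ?natrD;
  rewrite ?(addr0, add0r);
  try have d_ge0 := ler0n R d; try have k_ge0 := ler0n R k;
  by field; natr_neq0.
Qed.

Lemma path_formula_diag u k : path_formula u.+1 u.+1 k = path_formula u.+1 u k.
Proof.
have u_ge0 := ler0n R u; have k_ge0 := ler0n R k.
rewrite /path_formula !(addnS, addSn) ?factS_natr -!natr1 !natrD.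
by field; natr_neq0.
Qed.

Lemma path_formula_first k : path_formula 1 0 k = 1.
Proof.
have k_ge0 := ler0n R k.
by rewrite /path_formula addn0 add1n !factS_natr -!natr1; field; natr_neq0.
Qed.

Lemma prefix_formula_first k : prefix_formula false 0 0 k = 1.
Proof.
have k_ge0 := ler0n R k.
by rewrite /prefix_formula !add0n factS_natr -!natr1; field; natr_neq0.
Qed.

Lemma prefix_formula_sub q k :
  prefix_formula false q.+1 q k - prefix_formula true q.+1 q k =
    path_formula q.+1 q.+1 k.
Proof.
have q_ge0 := ler0n R q; have k_ge0 := ler0n R k.
rewrite /prefix_formula /path_formula !(addnS, addSn).
rewrite ?factS_natr -!natr1 !natrD.
by field; natr_neq0.
Qed.

Lemma prefix_formula_rec p q k : (q <= p <= q.+1)%N ->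
  prefix_formula false q.+1 p k =
    prefix_formula false p q k + prefix_formula true p q k +
    (if k is k'.+1 then prefix_formula true q.+1 p k' else 0).
Proof.
move=> pq; have q_ge0 := ler0n R q.
have {pq} [->|->] : p = q \/ p = q.+1 by lia.
all: case: k => [|k]; rewrite /prefix_formula !(addnS, addSn, addn0);
  rewrite ?factS_natr -!natr1 ?natrD;
  try have k_ge0 := ler0n R k; by field; natr_neq0.
Qed.

Lemma path_formula_factorials u k :
  path_formula u.+1 u.+1 k * (k`! * u.+1`! * (u`! * (u + k).+2`!))%:R =
  ((u + k)`! * (u + u + k).+2`!)%:R.
Proof.
have u_ge0 := ler0n R u; have k_ge0 := ler0n R k.
rewrite /path_formula !(addnS, addSn) !(factS, natrM) -!natr1 !natrD.
by field; natr_neq0.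
Qed.

Lemma prefix_formula_factorials (e : bool) p q k :
  let m := ((if e then p else q) + k)%N in
  prefix_formula e p q k * (k`! * p`! * (q`! * m.+1`!))%:R =
  (m`! * (p + q + k).+1`!)%:R.
Proof.
move=> m; have m_ge0 := ler0n R m.
rewrite /prefix_formula -/m [m.+1`!]factS !natrM -natr1; field; natr_neq0.
Qed.

Lemma npathsE l u d k : l = (u.+1 + d + k)%N -> (d <= u.+1)%N ->
  (npaths l (u.+1 - d)%N k)%:R = path_formula u.+1 d k.
Proof.
elim: l u d k => // l IHl u d k El; rewrite leq_eqVlt => /predU1P[Ed|].
  rewrite Ed subnn npathsS add0n addn0 path_formula_diag -IHl; [|lia|lia].
  by rewrite subSn // subnn.
rewrite ltnS => le_du; rewrite subSn // npathsS !natrD.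
have -> : (npaths l (u - d)%N.+2 k)%:R =
    if d is d'.+1 then path_formula u.+1 d' k else 0.
  case: d El le_du => [|d] El le_du; first by rewrite npaths_small //; lia.
  by rewrite -IHl; [congr ((npaths _ _ _)%:R); lia | lia | lia].
have -> : (if k is k'.+1 then npaths l (u - d).+1 k' else 0)%N%:R =
    if k is k'.+1 then path_formula u.+1 d k' else 0.
  case: k El => [|k] El //.
  by rewrite -IHl; [congr ((npaths _ _ _)%:R); lia | lia | lia].
case: u El le_du => [|u] El le_du; last first.
  by rewrite path_formula_rec -IHl //; lia.
have Ed : d = 0%N by lia.
rewrite Ed (_ : l = k) ?npaths_flat ?path_formula_first; last by lia.
by case: k {El} => [|k]; rewrite ?path_formula_first /= ?addr0 ?add0r.
Qed.

Lemma nprefixes_positive l p q k : l = (p + q + k).+1 -> (q <= p <= q.+1)%N ->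
  (nprefixes 0 l k)%:R = prefix_formula false p q k ->
  (nprefixes 1 l k)%:R = prefix_formula true p q k.
Proof.
move=> El pq; rewrite nprefixes_npaths natrD.
have [Epq|Epq] : p = q \/ p = q.+1 by lia.
  by rewrite npaths_odd ?addr0 /prefix_formula ?Epq // El; lia.
have := @npathsE l q q.+1 k; rewrite subnn => npaths_diag.
by rewrite npaths_diag ?El ?Epq -?prefix_formula_sub //; [lra | lia].
Qed.

Lemma nprefixes_all l p q k : l = (p + q + k).+1 -> (q <= p <= q.+1)%N ->
  (nprefixes 0 l k)%:R = prefix_formula false p q k.
Proof.
elim: l p q k => // l IHl p q k [El] pq.
have IHl1 p' q' k' El' pq' := nprefixes_positive El' pq' (IHl p' q' k' El' pq').
rewrite nprefixesS !natrD; case: p El pq => [|p] El pq.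
  have -> : q = 0%N by lia.
  have {}El : l = k by lia.
  rewrite prefix_formula_first (nprefixes_flat false)
    ?(nprefixes_flat true) El //=.
  case: k El => [|k] El; first by rewrite !addr0.
  rewrite -El (IHl1 0%N 0%N) // El !add0r; exact: prefix_formula_first.
have El' : l = (q + p + k).+1 by lia.
have pq' : (p <= q <= p.+1)%N by lia.
rewrite (IHl _ _ _ El' pq') (IHl1 _ _ _ El' pq') prefix_formula_rec //.
congr (_ + _).
by case: k El {El'} => // k El; rewrite (IHl1 p.+1 q k) //; lia.
Qed.

Lemma nprefixesE (e : bool) l p q k :
  l = (p + q + k).+1 -> (q <= p <= q.+1)%N ->
  (nprefixes e l k)%:R = prefix_formula e p q k.
Proof.
by move=> El pq; case: e; [apply: nprefixes_positive => // |];
  apply: nprefixes_all.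
Qed.

End ClosedForms.
End PathCounts.

Section SymmetricWords.
Local Open Scope nat_scope.
Implicit Types (e : bool) (l k : nat) (w : seq letter).

Definition nsymmetric l k : nat :=
  count (fun w => dyck_word 0 k w && (flip w == w)) (words l).

Definition unfold_word e w : seq letter :=
  flip w ++ nseq e (true, true) ++ w.

Lemma flip_unfold e w : flip (unfold_word e w) = unfold_word e w.
Proof. by rewrite /unfold_word !flip_cat flipK -catA; case: e. Qed.

Lemma unfold_in_words e l w :
  w \in words l -> unfold_word e w \in words (l + e + l).
Proof.
rewrite !mem_words !size_cat !all_cat size_flip all_flip size_nseq addnA.
by case/andP=> /eqP-> ->; rewrite eqxx andbT; case: e.
Qed.

Lemma dyck_word_unfold e w k :
  dyck_word 0 (k + e + k) (unfold_word e w) = dyck_prefix e k w.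
Proof.
rewrite /dyck_word /dyck_prefix /doubles !count_cat.
rewrite -![count _ _]/(doubles _) doubles_flip.
rewrite (_ : doubles (nseq e _) = e); last by case: e.
rewrite (_ : (_ + _ == k + e + k) = (doubles w == k)); last by lia.
congr (_ && _); rewrite !run_cat.
case: (run w 0) (@run_flip w 0) => //= h /(_ _ erefl) flipE.
case: e => /=; last by rewrite flipE eqxx.
by rewrite /step; case: h flipE => [|h] //= flipE;
  rewrite subn1 addn1 flipE eqxx.
Qed.

Lemma symmetric_unfold e l w : w \in words (l + e + l) -> flip w = w ->
  unfold_word e (drop (l + e) w) = w.
Proof.
rewrite mem_words => /andP[/eqP size_w all_w] sym_w.
set v := drop (l + e) w; set m := take e (drop l w); set u := take l w.
have wE : w = u ++ m ++ v by rewrite /v addnC -drop_drop !cat_take_drop.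
have size_u : size u = l by rewrite size_takel // size_w; lia.
have size_v : size v = l by rewrite size_drop size_w; lia.
have size_m : size m = e by rewrite size_takel // size_drop size_w; lia.
have : flip v ++ flip m ++ flip u == u ++ m ++ v.
  by rewrite catA -!flip_cat -wE sym_w.
rewrite !eqseq_cat ?size_flip ?size_u ?size_v //.
case/and3P=> /eqP uE /eqP mE _; rewrite wE -uE; congr (_ ++ (_ ++ _)).
have : all (mem letters) m by move: all_w; rewrite wE !all_cat => /and3P[].
by case: m mE size_m {wE} => [|[[] []] [|y m]] // mE; case: (e).
Qed.

Lemma nsymmetricE e l k : nsymmetric (l + e + l) (k + e + k) = nprefixes e l k.
Proof.
apply/esym; apply: (eq_count_can_in (f := unfold_word e) (g := drop (l + e))) =>
  [||w w_in|w w_in].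
- exact: uniq_words.
- exact: uniq_words.
- rewrite -dyck_word_unfold => ->.
  rewrite unfold_in_words // flip_unfold eqxx; split=> //.
  rewrite /unfold_word catA drop_size_cat // size_cat size_flip size_nseq.
  by move: w_in; rewrite mem_words => /andP[/eqP->].
case/andP=> dyck_w /eqP/(symmetric_unfold w_in) unfoldE.
rewrite -dyck_word_unfold unfoldE; split=> //.
move: w_in; rewrite !mem_words => /andP[/eqP size_w].
rewrite -{1}unfoldE /unfold_word !all_cat => /and3P[_ _ ->].
by rewrite size_drop size_w andbT; apply/eqP; lia.
Qed.

End SymmetricWords.

Lemma mem_fixed_points (A : choiceType) (X : {fset A}) (c : A -> A) x :
  (x \in fixed_points X c) = (x \in X) && (c x == x).
Proof. by rewrite !inE. Qed.

Section Cardinals.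
Local Open Scope nat_scope.
Variables (n k : nat).
Hypotheses (n_gt0 : 0 < n) (le_k2n : k <= 2 * n).

Lemma card_Inc_npaths : #|` Inc [:: n; n] k| = npaths (2 * n - k) 0 k.
Proof.
rewrite -[LHS]count_predT.
apply: (eq_count_can_in (f := @word n) (g := @tableau_of n)).
- exact: fset_uniq.
- exact: uniq_words.
- move=> T; rewrite mem_Inc => IncT _; have [] := word_dyck n_gt0 IncT.
  by rewrite (tableau_of_word n_gt0 IncT).
- move=> w w_in dyck_w; rewrite mem_Inc.
  by have [] := tableau_of_dyck n_gt0 le_k2n w_in dyck_w.
Qed.

Lemma Kevacuation_Inc T : T \in Inc [:: n; n] k -> Kevacuation T = rotate T.
Proof. by rewrite mem_Inc => /andP[incT _]; apply: Kevacuation_rotate. Qed.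

Lemma card_fixed_nsymmetric :
  #|` fixed_points (Inc [:: n; n] k) (@Kevacuation [:: n; n])| =
    nsymmetric (2 * n - k) k.
Proof.
rewrite -[LHS]count_predT.
apply: (eq_count_can_in (f := @word n) (g := @tableau_of n)).
- exact: fset_uniq.
- exact: uniq_words.
- move=> T; rewrite mem_fixed_points => /andP[T_in /eqP].
  rewrite Kevacuation_Inc // => rotT _.
  rewrite mem_Inc in T_in; have [word_in dyckT] := word_dyck n_gt0 T_in.
  rewrite word_in dyckT -(word_rotate n_gt0 T_in) rotT eqxx.
  by rewrite (tableau_of_word n_gt0 T_in).
- move=> w w_in /andP[dyck_w /eqP sym_w].
  have [T_in wordE] := tableau_of_dyck n_gt0 le_k2n w_in dyck_w.
  rewrite mem_fixed_points mem_Inc T_in Kevacuation_Inc ?mem_Inc // wordE.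
  split=> //.
  have rotT_in := rotate_Inc n_gt0 T_in.
  by rewrite -(tableau_of_word n_gt0 rotT_in)
    (word_rotate n_gt0 T_in) wordE sym_w eqxx.
Qed.

End Cardinals.

Section CardinalFormulas.
Local Open Scope nat_scope.
Variables (n k : nat).
Hypothesis lt_kn : k < n.

Lemma card_Inc_formula :
  #|` Inc [:: n; n] k| * (k`! * (n - k)`! * ((n - k).-1`! * n.+1`!)) =
    n.-1`! * (2 * n - k)`!.
Proof.
have n_gt0 : 0 < n by lia.
have [u nE] : {u | n = u.+1 + k} by exists (n - k).-1; lia.
rewrite card_Inc_npaths //; last by lia.
have := @path_formula_factorials rat u k.
rewrite -(@npathsE rat _ u u.+1 k erefl) // subnn -natrM => /eqP.
rewrite eqr_nat => /eqP.
have -> : 2 * n - k = u.+1 + u.+1 + k by lia.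
have -> : n - k = u.+1 by lia.
have -> : n.+1 = (u + k).+2 by lia.
have -> : n.-1 = u + k by lia.
by rewrite addnS !addSn.
Qed.

Lemma card_fixed_formula :
  #|` fixed_points (Inc [:: n; n] k) (@Kevacuation [:: n; n])| *
    (k./2`! * (n - k)./2`! * ((n - k).-1./2`! * n.+1./2`!)) =
    n.-1./2`! * (2 * n - k)./2`!.
Proof.
have n_gt0 : 0 < n by lia.
rewrite card_fixed_nsymmetric //; last by lia.
set e := odd k; set j := k./2; set p := (n - k)./2; set q := (n - k).-1./2.
have kE : k = j + e + j by rewrite /j /e; lia.
have := @prefix_formula_factorials rat e p q j.
rewrite /= -(@nprefixesE rat e (p + q + j).+1) //; last by rewrite /p /q; lia.
rewrite -natrM => /eqP; rewrite eqr_nat => /eqP.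
rewrite -nsymmetricE -kE.
have -> : (p + q + j).+1 + e + (p + q + j).+1 = 2 * n - k.
  by rewrite /p /q /j /e; lia.
have -> : ((if e then p else q) + j).+1 = n.+1./2.
  by rewrite /p /q /j /e; case: ifP; lia.
have -> : (if e then p else q) + j = n.-1./2.
  by rewrite /p /q /j /e; case: ifP; lia.
by have -> : (p + q + j).+1 = (2 * n - k)./2 by rewrite /p /q /j; lia.
Qed.

End CardinalFormulas.

(** * Values of the q-analogue *)

Section QValues.
Local Notation "p %:F" := (tofrac p).
Implicit Types (n k m : nat) (x : algC).

Lemma qfactS m : qfact m.+1 = qfact m * qint m.+1.
Proof. by rewrite /qfact big_nat_recr. Qed.

Lemma horner_qint1 m : (qint m).[1] = m%:R.
Proof.
rewrite /qint horner_sum (eq_bigr (fun=> 1)) => [|i _]; last first.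
  by rewrite hornerXn expr1n.
by rewrite sumr_const card_ord.
Qed.

Lemma horner_qfact1 m : (qfact m).[1] = m`!%:R.
Proof.
elim: m => [|m IHm]; first by rewrite /qfact big_geq // hornerC.
by rewrite qfactS hornerM IHm horner_qint1 -natrM mulnC.
Qed.

Lemma qintSS m : qint m.+2 = qint m + 'X^m * (1 + 'X).
Proof. by rewrite /qint !big_ord_recr /= -addrA mulrDr mulr1 -exprSr. Qed.

Lemma qint_double m : exists2 g, qint m.*2 = (1 + 'X) * g & g.[-1] = m%:R.
Proof.
elim: m => [|m [g qintE g_val]].
  by exists 0; rewrite ?horner0 // mulr0 /qint big_ord0.
exists (g + 'X^(m.*2)).
  by rewrite doubleS qintSS qintE [RHS]mulrDr; congr (_ + _); apply: mulrC.
by rewrite hornerD hornerXn g_val -mul2n exprM sqrrN !expr1n natr1.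
Qed.

Lemma horner_qint_odd m : (qint m.*2.+1).[-1] = 1.
Proof.
elim: m => [|m IHm]; first by rewrite /qint big_ord1 expr0 hornerC.
rewrite doubleS qintSS hornerD IHm hornerM hornerD hornerC hornerX.
by rewrite subrr mulr0 addr0.
Qed.

Lemma qfact_half m :
  exists2 g, qfact m = (1 + 'X) ^+ m./2 * g & g.[-1] = m./2`!%:R.
Proof.
elim: m => [|m [g qfactE g_val]].
  by exists 1; rewrite ?hornerC // mulr1 /qfact big_geq.
have := odd_double_half m.+1; rewrite /= uphalf_half.
case: (odd m) => /= mE.
  have [g' qintE g'_val] := qint_double (m./2).+1.
  exists (g * g'); last first.
    by rewrite hornerM g_val g'_val -natrM add1n factS mulnC.
  by rewrite qfactS qfactE -mE add1n add0n qintE exprSr mulrACA.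
exists (g * qint m.+1); first by rewrite qfactS qfactE mulrA.
by rewrite hornerM g_val -mE add0n add1n horner_qint_odd mulr1.
Qed.

Lemma has_value_cancel (c p d : {poly algC}) x : c != 0 -> d.[x] != 0 ->
  has_value ((c * p)%:F / (c * d)%:F) x (p.[x] / d.[x]).
Proof.
move=> c_neq0 d_neq0; exists p, d; split=> //.
by rewrite !rmorphM /= invfM mulrACA divff ?mul1r // tofrac_eq0.
Qed.

Lemma fnkE n k : (k < n)%N -> fnk n k =
  (qfact n.-1 * qfact (2 * n - k))%:F /
  (qfact k * qfact (n - k) * (qfact (n - k).-1 * qfact n.+1))%:F.
Proof.
move=> lt_kn; rewrite /fnk /qbinom.
have -> : (n - 1)%N = n.-1 by lia.
have -> : (n.-1 - k)%N = (n - k).-1 by lia.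
have -> : (n - k - 1)%N = (n - k).-1 by lia.
have -> : (2 * n - k - (n - k).-1)%N = n.+1 by lia.
have -> : qfact (n - k) = qfact (n - k).-1 * qint (n - k).
  by rewrite -{1 3}(@prednK (n - k)) ?qfactS //; lia.
by rewrite !rmorphM /= !invfM; ring.
Qed.

(* The powers of c carry the common zeros at x of the numerator and the
   denominator. *)
Lemma has_value_fnk_factor (c : {poly algC}) (e v : nat -> nat) x n k N :
  (k < n)%N -> c != 0 -> (forall m, 0 < v m)%N ->
  (forall m, exists2 g, qfact m = c ^+ e m * g & g.[x] = (v m)%:R) ->
  (e n.-1 + e (2 * n - k) = e k + e (n - k) + (e (n - k).-1 + e n.+1))%N ->
  (N * (v k * v (n - k) * (v (n - k).-1 * v n.+1)) =
    v n.-1 * v (2 * n - k))%N ->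
  has_value (fnk n k) x N%:R.
Proof.
move=> lt_kn c_neq0 v_gt0 qfactE e_bal NE; rewrite fnkE //.
have [g1 -> v1] := qfactE n.-1; have [g2 -> v2] := qfactE (2 * n - k)%N.
have [g3 -> v3] := qfactE k; have [g4 -> v4] := qfactE (n - k)%N.
have [g5 -> v5] := qfactE (n - k).-1; have [g6 -> v6] := qfactE n.+1.
rewrite mulrACA -exprD e_bal (mulrACA _ g3) (mulrACA _ g5)
  (mulrACA (_ * _)) -!exprD.
have denE : (g3 * g4 * (g5 * g6)).[x] =
    (v k * v (n - k) * (v (n - k).-1 * v n.+1))%N%:R.
  by rewrite !hornerM v3 v4 v5 v6 -!natrM.
have den_neq0 : (g3 * g4 * (g5 * g6)).[x] != 0.
  by rewrite denE pnatr_eq0 -lt0n !muln_gt0 !v_gt0.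
have -> : N%:R = (g1 * g2).[x] / (g3 * g4 * (g5 * g6)).[x].
  by apply: (canRL (mulfK den_neq0)); rewrite denE hornerM v1 v2 -!natrM NE.
by apply: has_value_cancel; rewrite ?expf_neq0.
Qed.

Lemma has_value_fnk1 n k : (k < n)%N ->
  has_value (fnk n k) 1 #|` Inc [:: n; n] k|%:R.
Proof.
move=> lt_kn; apply: (@has_value_fnk_factor 1 (fun=> 0%N) factorial) => //.
- exact: oner_neq0.
- exact: fact_gt0.
- by move=> m; exists (qfact m); rewrite ?mul1r ?horner_qfact1.
- exact: card_Inc_formula.
Qed.

Lemma has_value_fnkN1 n k : (k < n)%N -> has_value (fnk n k) (-1)
  #|` fixed_points (Inc [:: n; n] k) (@Kevacuation [:: n; n])|%:R.
Proof.
move=> lt_kn.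
apply: (@has_value_fnk_factor (1 + 'X) half (fun m => (m./2)`!)) => //.
- by rewrite addrC -[1]opprK -polyCN polyXsubC_eq0.
- by move=> m; apply: fact_gt0.
- exact: qfact_half.
- by lia.
- exact: card_fixed_formula.
Qed.

Lemma cyclic_sieving_involution (A : choiceType) (X : {fset A}) (c : A -> A)
    (f : {fraction {poly algC}}) :
  {in X, forall a, c a \in X} -> {in X, forall a, c (c a) = a} ->
  has_value f 1 #|` X|%:R -> has_value f (-1) #|` fixed_points X c|%:R ->
  cyclic_sieving X 2 c f.
Proof.
move=> cX cK val1 valN1; split=> // z m z_prim.
have zN1 : z = -1.
  have /eqP := prim_expr_order z_prim; rewrite sqrf_eq1 => /pred2P[z1|//].
  by have := prim_order_dvd z_prim 1; rewrite z1 expr1n eqxx.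
have -> : z ^ m = (-1) ^ (m %% 2)%Z.
  rewrite zN1 {1}(divz_eq m 2) [(m %/ 2)%Z * 2]mulrC.
  rewrite expfzDr ?oppr_eq0 ?oner_eq0 //.
  by rewrite -exprz_exp -exprnP sqrrN expr1n exp1rz mul1r.
have := modz_ge0 m (isT : (2 : int) != 0).
have := ltz_pmod m (isT : 0 < (2 : int)).
case: (m %% 2)%Z => [[|[|r]]|r] // _ _.
rewrite expr0z /= (_ : fixed_points X id = X) //.
by apply/fsetP => a; rewrite mem_fixed_points eqxx andbT.
Qed.

End QValues.

Theorem theorem1p2 (n k : nat) (hn : (1 <= n)%N) (hk : (k <= n - 1)%N) :
  [/\ cyclic_sieving (Inc [:: n; n] k) 2 (@Kevacuation [:: n; n]) (fnk n k),
      has_value (fnk n k) 1 (#|` Inc [:: n; n] k|%:R)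
    & has_value (fnk n k) (-1)
        (#|` fixed_points (Inc [:: n; n] k) (@Kevacuation [:: n; n])|%:R)].
Proof.
have lt_kn : (k < n)%N by lia.
have val1 := has_value_fnk1 lt_kn; have valN1 := has_value_fnkN1 lt_kn.
have evac_rotate := Kevacuation_Inc hn (k := k).
have rotateX T : T \in Inc [:: n; n] k -> rotate T \in Inc [:: n; n] k.
  by rewrite !mem_Inc; apply: rotate_Inc.
split=> //; apply: cyclic_sieving_involution => // T T_in.
  by rewrite evac_rotate ?rotateX.
rewrite !evac_rotate ?rotateX //; rewrite mem_Inc in T_in.
exact: rotateK T_in.
Qed.
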